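(* Let $f(2,n)$ be the number of primitive lattice triangulations of a $2\times n$ rectangle. Then $$\lim_{n\to\infty} f(2,n)^{1/n}=\alpha,\qquad \alpha=\frac{611+\sqrt{73}}{36},$$ and hence $c_2=\frac12\log_2\alpha = 2.05256897\ldots$
   Context: A lattice triangulation of a polygon in $\mathbb R^2$ with vertices in $\mathbb Z^2$ is a triangulation with all vertices in $\mathbb Z^2$. It is primitive (unimodular) if every triangle has the minimal possible area $1/2$. $f(m,n)$ denotes the number of primitive lattice triangulations of the rectangle $[0,m]\times[0,n]$. Put $c(m,n)=\frac{\log_2 f(m,n)}{mn}$ and $c_m=\sup_n c(m,n)=\lim_{n\to\infty}c(m,n)$ (the limit is known to exist). *)

(* Defs.v *)
From HB Require Import structures.
From mathcomp Require Import all_boot all_order all_algebra.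
From mathcomp Require Import all_classical all_reals all_analysis.
Import Order.TTheory GRing.Theory Num.Theory.
Import numFieldNormedType.Exports.
Local Open Scope classical_set_scope.
Local Open Scope ring_scope.

(* The points of Z^2 in [0,m]x[0,n]. A triangulation of this rectangle has all
   its vertices in the rectangle, so for a lattice triangulation they are
   exactly of this type. *)
Definition lattice_pt (m n : nat) : finType := ('I_m.+1 * 'I_n.+1)%type.

Definition rectangle (R : realType) (m n : nat) : set (R * R) :=
  [set x | 0 <= x.1 <= m%:R /\ 0 <= x.2 <= n%:R].

Definition conv_hull (R : realType) {m n : nat} (s : {set lattice_pt m n}) :
    set (R * R) :=
  [set x | exists w : lattice_pt m n -> R,
     [/\ forall p, p \in s -> 0 <= w p,
         \sum_(p in s) w p = 1,
         x.1 = \sum_(p in s) w p * (p.1 : nat)%:R &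
         x.2 = \sum_(p in s) w p * (p.2 : nat)%:R]].

Definition triangle_area (R : realType) {m n : nat} (p q r : lattice_pt m n) : R :=
  let x (a : lattice_pt m n) : R := (a.1 : nat)%:R in
  let y (a : lattice_pt m n) : R := (a.2 : nat)%:R in
  `|(x q - x p) * (y r - y p) - (x r - x p) * (y q - y p)| / 2.

Definition is_triangle (R : realType) {m n : nat} (t : {set lattice_pt m n}) : Prop :=
  exists p q r, t = [set p; q; r]%SET /\ triangle_area R p q r != 0.

(* A triangulation is given by its set of triangles, each triangle by its
   vertex set. The common face [r] in the third clause may be empty. *)
Definition lattice_triangulation (R : realType) {m n : nat}
    (T : {set {set lattice_pt m n}}) : Prop :=
  [/\ forall t, t \in T -> is_triangle R t,
      \bigcup_(t in [set t | t \in T]) conv_hull R t = rectangle R m n &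
      forall s t, s \in T -> t \in T ->
        exists r : {set lattice_pt m n},
          [/\ r \subset s, r \subset t &
              conv_hull R s `&` conv_hull R t = conv_hull R r]].

Definition primitive_triangulation (R : realType) {m n : nat}
    (T : {set {set lattice_pt m n}}) : Prop :=
  lattice_triangulation R T /\
  forall p q r, [set p; q; r]%SET \in T -> triangle_area R p q r = 1 / 2.

Definition f (R : realType) (m n : nat) : nat :=
  #|[set T : {set {set lattice_pt m n}} | `[< primitive_triangulation R T >]]%SET|.

Definition log2 {R : realType} (x : R) : R := ln x / ln 2.

Definition c (R : realType) (m n : nat) : R :=
  log2 (f R m n)%:R / (m%:R * n%:R).

(* The supremum ranges over n >= 1: the rectangle is degenerate for n = 0. *)
Definition c_sup (R : realType) (m : nat) : R :=
  sup [set c R m n | n in [set n : nat | (0 < n)%N]].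

Definition alpha (R : realType) : R := (611 + Num.sqrt 73) / 36.

(* Main.v *)
(* In a primitive triangulation of [0,2]x[0,n] an edge between the outer columns
   x = 0 and x = 2 passes through the middle of a unit segment of the column
   x = 1, and its two triangles form a parallelogram whose other diagonal is that
   segment. So a triangulation amounts to two triangulated strips of width 1 and
   a set of flipped middle segments: if l_j and r_j are the heights of the
   apexes over [j, j+1] on the left and on the right, then l and r are weakly
   increasing with values in [0, n], and the segment is flippable exactly when
   l_j + r_j = 2j+1.

   Dropping the separate end conditions on l and r and keeping only the one on
   l + r costs a polynomial factor, and S_j = l_j + r_j is then a walk with
   weights s+1 for steps of length s; cut at its flipped segments it becomes a
   renewal process with bridges counted by u_d = C(4d-1,2d). The growth rate is
   the alpha with sum_d u_d alpha^-d = 1, that is sum_k C(4k,2k) alpha^-k = 3, and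
   the even part of sum_m C(2m,m) x^m = (1-4x)^(-1/2) gives alpha. Gluing
   triangulations gives f(2,n)^k <= f(2,kn), so alpha^n bounds f(2,n) for
   every n. *)
Require Import Defs.
From HB Require Import structures.
From mathcomp Require Import all_boot all_order all_algebra.
From mathcomp Require Import all_classical all_reals all_analysis.
From mathcomp Require Import zify ring lra.
Import Order.TTheory GRing.Theory Num.Theory.
Import numFieldNormedType.Exports.
Set Implicit Arguments. Unset Strict Implicit. Unset Printing Implicit Defensive.

(** * Counting pairs of profiles *)

(** The correspondence with profiles is proved without counting triangles or areas. A triangulation
    contained in another one equals it, so only inclusions have to be checked. Inside a strip of
    width 1 the crossing edges, from height a on the outer column to height c on the middle one, are
    totally ordered by a + c; covering and compatibility of faces there follow from this order.
    Conversely, a crossing of two edges of a given triangulation would force too many vertices into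
    one triangle, which makes the apexes monotone.

    The renewal formula counts profiles by total height, whereas f(2,n) bounds the two heights
    separately. One comparison is an inclusion; in the other, the gluing is arranged so that the two
    unknown end heights add up to a diagonal box.

    No singularity analysis occurs. The renewal mass at alpha is 1 in the limit, so an induction
    compares the weights with C b^k for b on either side of alpha, and the constants disappear after
    taking logarithms. The power (1-4x)^(-1/2) is likewise obtained from squares of real partial
    sums. *)

Lemma leq_sum_ord (F : nat -> nat) m n : m <= n ->
  \sum_(i < m) F i <= \sum_(i < n) F i.
Proof.
move=> le_mn; rewrite (big_ord_widen _ F le_mn) big_mkcond leq_sum // => i _.
by case: ifP.
Qed.

(* Number of profiles of length [k] with heights at most [p] on the left and [q]
   on the right; the recursion removes the last entry. *)
Fixpoint nconf k p q :=
  if k is k'.+1 then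
    \sum_(x < p.+1) \sum_(y < q.+1) (1 + (x + y == k'.*2.+1)) * nconf k' x y
  else 1.

Definition antidiag (G : nat -> nat -> nat) s := \sum_(x < s.+1) G x (s - x).

Lemma antidiagC G s : antidiag G s = antidiag (fun x y => G y x) s.
Proof.
rewrite /antidiag (reindex_inj rev_ord_inj) /=; apply: eq_bigr => x _.
by rewrite subSS subKn // -ltnS.
Qed.

(** Both sides sum [G i y] over the triangle [i + y <= s], sliced in different directions. *)
Lemma antidiag_psum (G : nat -> nat -> nat) s :
  antidiag (fun x y => \sum_(i < x.+1) G i y) s = \sum_(v < s.+1) antidiag G v.
Proof.
elim: s => [|s IH]; first by rewrite /antidiag !big_ord1.
rewrite big_ord_recr /= -IH /antidiag [LHS]big_ord_recl /= big_ord1.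
under eq_bigr => i _ do rewrite big_ord_recr /= /bump /= add1n subSS.
rewrite big_split /= addnCA; congr (_ + _).
by rewrite [RHS]big_ord_recl /= subn0; congr (_ + _).
Qed.

Definition nconf_tot k := antidiag (nconf k).

Lemma nconf_tot0 s : nconf_tot 0 s = s.+1.
Proof. by rewrite /nconf_tot /antidiag /= sum_nat_const card_ord muln1. Qed.

(** The flip condition depends only on [x + y], so the sum over a box becomes two successive partial
    sums in the total height, one for each coordinate. This is where a step of length d gets its
    weight d + 1. *)
Lemma nconf_totS k s : nconf_tot k.+1 s =
  \sum_(v < s.+1) \sum_(w < v.+1) (1 + (w == k.*2.+1 :> nat)) * nconf_tot k w.
Proof.
pose G x y := (1 + (x + y == k.*2.+1)) * nconf k x y.
transitivity (antidiag (fun x y => \sum_(i < x.+1) \sum_(j < y.+1) G i j) s).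
  by [].
rewrite (antidiag_psum (fun i y => \sum_(j < y.+1) G i j)); apply: eq_bigr => v _.
rewrite antidiagC (antidiag_psum (fun j i => G i j)); apply: eq_bigr => w _.
rewrite antidiagC /nconf_tot /antidiag big_distrr /=; apply: eq_bigr => x _.
by rewrite /G subnKC // -ltnS.
Qed.

Lemma nconf_tot_mono k s t : s <= t -> nconf_tot k s <= nconf_tot k t.
Proof.
case: k => [|k] le_st; first by rewrite !nconf_tot0.
rewrite !nconf_totS.
exact: (leq_sum_ord (fun v =>
  \sum_(w < v.+1) (1 + (w == k.*2.+1 :> nat)) * nconf_tot k w)).
Qed.

Lemma hockey_stick r s : \sum_(v < s.+1) 'C(v + r, r) = 'C(s + r.+1, r.+1).
Proof.
elim: s => [|s IH]; first by rewrite big_ord1 !add0n !binn.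
by rewrite big_ord_recr /= IH [in RHS]addSn binS addSnnS.
Qed.

(** The coefficient of z^s in z^m / (1 - z)^(r+1); a partial sum multiplies by 1 / (1 - z). *)
Definition shbin m r s := if m <= s then 'C(s - m + r, r) else 0.

Lemma sum_shbin m r s : \sum_(v < s.+1) shbin m r v = shbin m r.+1 s.
Proof.
elim: s => [|s IH].
  by rewrite big_ord1 /shbin; case: m => // ; rewrite !add0n !binn.
rewrite big_ord_recr /= IH /shbin; case: (ltngtP m s.+1) => [lt_ms|gt_ms|->].
- by rewrite -ltnS lt_ms subSn // [in RHS]addSn binS addSnnS.
- by rewrite leqNgt (ltnW gt_ms).
- by rewrite ltnn subnn !add0n !binn.
Qed.

(** Weight of the prefixes of length [i] followed by an entry of total height 2i + 1, the height at
    which segment [i] can be flipped. *)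
Definition nmark i := nconf_tot i i.*2.+1.

(** Split by the last flip [i]; the first term has none. Beyond total height 2i + 1 all steps are
    free, and the remaining entries and the end point contribute 2(k - i) partial sums. *)
Lemma nconf_tot_renewal k s : nconf_tot k s =
  'C(s + k.*2.+1, k.*2.+1) +
  \sum_(i < k) shbin i.*2.+1 (k - i).*2.-1 s * nmark i.
Proof.
elim: k s => [|k IH] s; first by rewrite nconf_tot0 big_ord0 bin1 addn1 addn0.
have dbl w : \sum_(x < w.+1) (1 + (x == k.*2.+1 :> nat)) * nconf_tot k x =
    \sum_(x < w.+1) nconf_tot k x + shbin k.*2.+1 0 w * nmark k.
  under eq_bigr => x _ do rewrite mulnDl mul1n.
  rewrite big_split /=; congr (_ + _); rewrite /shbin.
  case: (leqP k.*2.+1 w) => [le_kw|lt_wk].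
    rewrite (bigD1 (Ordinal (le_kw : k.*2.+1 < w.+1))) //= eqxx bin0.
    rewrite big1 ?addn0 // => i; rewrite -val_eqE /= => /negPf ->.
    by rewrite mul0n.
  rewrite big1 ?mul0n // => i _; have := ltn_ord i; case: eqP => //; lia.
rewrite nconf_totS; under eq_bigr => v _ do rewrite dbl.
rewrite big_split /= -big_distrl /= sum_shbin.
under eq_bigr => v _ do (under eq_bigr => x _ do rewrite IH; rewrite big_split /= hockey_stick exchange_big /=).
rewrite big_split /= hockey_stick -addnA; congr (_ + _).
rewrite [RHS]big_ord_recr /= subSnn exchange_big /=; congr (_ + _).
apply: eq_bigr => i _; under eq_bigr => v _ do rewrite -big_distrl /= sum_shbin.
rewrite -big_distrl /= sum_shbin; congr (shbin _ _ _ * _).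
by have := ltn_ord i; lia.
Qed.

Lemma nmark_renewal k : nmark k = 'C(k.*2.+1.*2, k.*2.+1) +
  \sum_(i < k) 'C((k - i).*2.*2.-1, (k - i).*2) * nmark i.
Proof.
rewrite /nmark nconf_tot_renewal; congr ('C(_, _) + _); first by lia.
apply: eq_bigr => i _; congr (_ * _); have lt_ik := ltn_ord i.
rewrite /shbin ifT; last by lia.
rewrite -bin_sub; last by lia.
by congr ('C(_, _)); lia.
Qed.

(** * Monotonicity and gluing of profiles *)

Lemma nconf_mono k p q p' q' : p <= p' -> q <= q' -> nconf k p q <= nconf k p' q'.
Proof.
case: k => //= k le_p le_q.
pose F x y := (1 + (x + y == k.*2.+1)) * nconf k x y.
apply: leq_trans (leq_sum_ord (fun x => \sum_(y < q'.+1) F x y) (le_p : p < p'.+1)).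
by apply: leq_sum => x _; apply: (leq_sum_ord (F x)).
Qed.

Lemma nconfC k p q : nconf k p q = nconf k q p.
Proof.
elim: k p q => //= k IH p q; rewrite exchange_big /=.
by apply: eq_bigr => x _; apply: eq_bigr => y _; rewrite [(y : nat) + x]addnC IH.
Qed.

Lemma sum_ord_shift (a b : nat) (F : nat -> nat) :
  \sum_(x < b.+1) F (a + x) <= \sum_(x < (a + b).+1) F x.
Proof.
elim: b => [|b IH]; first by rewrite big_ord1 addn0 big_ord_recr /= leq_addl.
by rewrite addnS big_ord_recr [leqRHS]big_ord_recr /= addnS leq_add2r.
Qed.

(** Raise the heights of the upper part by [p] and [q]. Since [p + q] is twice the shift [k] of the
    indices, its flippable entries remain flippable. *)
Lemma nconf_cat k l p q p' q' : p + q = k.*2 ->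
  nconf l p' q' * nconf k p q <= nconf (l + k) (p + p') (q + q').
Proof.
move=> pq; elim: l p' q' => [|l IH] p' q'.
  by rewrite mul1n nconf_mono // leq_addr.
rewrite addSn /=; apply: leq_trans (sum_ord_shift p p'
  (fun x => \sum_(y < (q + q').+1) (1 + (x + y == (l + k).*2.+1)) * nconf (l + k) x y)).
rewrite big_distrl leq_sum // => x _.
apply: leq_trans (sum_ord_shift q q' (fun y => (1 + (p + x + y == (l + k).*2.+1)) * nconf (l + k) (p + x) y)).
rewrite big_distrl leq_sum // => y _ /=.
by rewrite -mulnA leq_mul ?IH //; lia.
Qed.

Lemma nconf_diag_supermul m n : nconf m m m * nconf n n n <= nconf (m + n) (m + n) (m + n).
Proof. by have := @nconf_cat n m n n m m; rewrite [n + m]addnC addnn; apply. Qed.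

Lemma nconf_diag_gt0 n : 0 < nconf n n n.
Proof.
suff H p q : 0 < nconf n p q by [].
elim: n p q => //= n IH p q.
by rewrite big_ord_recl /= big_ord_recl /= -addnA ltn_addr // muln_gt0 IH.
Qed.

Lemma nconf_diag_exp n k : nconf n n n ^ k <= nconf (k * n) (k * n) (k * n).
Proof.
elim: k => [|k IH]; first by rewrite expn0 mul0n.
by rewrite expnS mulSn (leq_trans _ (nconf_diag_supermul _ _)) // leq_mul2l IH orbT.
Qed.

Lemma nconf_diag_le_nmark n : nconf n n n <= nmark n.
Proof.
apply: leq_trans (nconf_tot_mono n (leqnSn n.*2)).
rewrite /nconf_tot /antidiag -addnn.
by rewrite (bigD1 (Ordinal (leq_addr n n : n < (n + n).+1))) //= addnK leq_addr.
Qed.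

(* Pigeonhole on the split [2k = p + q], then glue a configuration to the
   mirror image of another one with the same split. *)
Lemma nconf_diag_ge n : nconf_tot n n.*2 ^ 2 <= n.*2.+1 ^ 2 * nconf n.*2 n.*2 n.*2.
Proof.
pose M := \max_(x < n.*2.+1) nconf n x (n.*2 - x).
have leM : nconf_tot n n.*2 <= n.*2.+1 * M.
  rewrite -[X in X * _]card_ord -sum_nat_const leq_sum // => x _.
  exact: (@leq_bigmax _ (fun x : 'I_n.*2.+1 => nconf n x (n.*2 - x)) x).
rewrite (leq_trans (_ : _ <= (n.*2.+1 * M) ^ 2)) ?leq_exp2r //.
rewrite expnMn leq_mul2l; apply/orP; right.
have /(bigop.eq_bigmax (fun x : 'I_n.*2.+1 => nconf n x (n.*2 - x))) [x eqM] : 0 < #|'I_n.*2.+1|.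
  by rewrite card_ord.
rewrite /M eqM -mulnn; have := ltn_ord x; rewrite ltnS => le_x.
have := @nconf_cat n n x (n.*2 - x) (n.*2 - x) x.
rewrite [nconf n (n.*2 - x) x]nconfC.
by rewrite subnKC // subnK // addnn; apply.
Qed.

(** The summand of [nconf_tot_renewal] with last flip [n] suffices. This passes from the odd level
    of [nmark] to an even level, as [nconf_diag_ge] requires. *)
Lemma nmark_le_nconf_tot n : nmark n <= nconf_tot n.+1 n.+1.*2.
Proof.
rewrite nconf_tot_renewal big_ord_recr /= addnCA addnA.
apply: (leq_trans _ (leq_addl _ _)); apply: leq_pmull.
rewrite /shbin ifT; last by lia.
by rewrite bin_gt0; lia.
Qed.

Local Open Scope classical_set_scope.
Local Open Scope ring_scope.

(** * Convex hulls of lattice points *)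

Section Geometry.
Variables (R : realType) (n : nat).
Local Notation pt := (lattice_pt 2 n).
Local Notation hull := (conv_hull R).

Definition Xc (p : pt) : int := (p.1 : nat)%:Z.
Definition Yc (p : pt) : int := (p.2 : nat)%:Z.
Definition aff (a b c : R) (x : R * R) : R := a * x.1 + b * x.2 + c.
Definition crd (p : pt) : R * R := ((p.1 : nat)%:R, (p.2 : nat)%:R).

(** The weights of [conv_hull] made explicit, because the face arguments compare barycentric
    coordinates. *)
Definition comb (s : {set pt}) (w : pt -> R) (x : R * R) : Prop :=
  [/\ forall p, p \in s -> 0 <= w p, \sum_(p in s) w p = 1,
      x.1 = \sum_(p in s) w p * (p.1 : nat)%:R &
      x.2 = \sum_(p in s) w p * (p.2 : nat)%:R].

Lemma comb_aff s w x a b c : comb s w x ->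
  aff a b c x = \sum_(p in s) w p * aff a b c (crd p).
Proof.
case=> _ w1 x1 x2; rewrite /aff x1 x2.
transitivity (a * \sum_(p in s) w p * (p.1 : nat)%:R +
  b * (\sum_(p in s) w p * (p.2 : nat)%:R) + (\sum_(p in s) w p) * c).
  by rewrite w1 mul1r.
rewrite !mulr_sumr mulr_suml -!big_split.
by apply: eq_bigr => p _ /=; rewrite !mulrDr ![a * _]mulrCA ![b * _]mulrCA.
Qed.

Lemma comb_restrict (s r : {set pt}) w x : r \subset s ->
  (forall p, p \in s -> p \notin r -> w p = 0) -> comb s w x -> comb r w x.
Proof.
move=> rs w0 [w_ge0 w1 x1 x2].
have restr (g : pt -> R) : (forall p, w p = 0 -> g p = 0) ->
    \sum_(p in s) g p = \sum_(p in r) g p.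
  move=> gw; rewrite (big_setID r) /= (finset.setIidPr rs) [X in _ + X]big1 ?addr0 //.
  by move=> p; rewrite inE => /andP[pr ps]; apply/gw/w0.
split; first by move=> p /(fintype.subsetP rs); apply: w_ge0.
- by rewrite -(restr w).
- by rewrite x1 restr // => p ->; rewrite mul0r.
- by rewrite x2 restr // => p ->; rewrite mul0r.
Qed.

Lemma comb_extend (s r : {set pt}) w x : r \subset s -> comb r w x ->
  comb s (fun p => if p \in r then w p else 0) x.
Proof.
move=> rs [w_ge0 w1 x1 x2].
have ext (g : pt -> R) (h : pt -> R): (forall p, g p = if p \in r then h p else 0) ->
    \sum_(p in s) g p = \sum_(p in r) h p.
  move=> gh; rewrite (big_setID r) /= (finset.setIidPr rs) [X in _ + X]big1 ?addr0.
    by apply: eq_bigr => p pr; rewrite gh pr.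
  by move=> p; rewrite inE gh => /andP[/negPf ->].
split.
- by move=> p ps; case: ifP => // /w_ge0.
- by rewrite (ext _ w).
- by rewrite x1 (ext _ (fun p => w p * (p.1 : nat)%:R)) // => p; case: ifP => // _; rewrite mul0r.
- by rewrite x2 (ext _ (fun p => w p * (p.2 : nat)%:R)) // => p; case: ifP => // _; rewrite mul0r.
Qed.

Lemma hull_sub (s r : {set pt}) : r \subset s -> hull r `<=` hull s.
Proof. by move=> rs x [w wx]; eexists; exact: (comb_extend rs wx). Qed.

(** Twice the signed area, kept in the integers so that orientations are decided by integer
    arithmetic. *)
Definition cross (p q r : pt) : int :=
  (Xc q - Xc p) * (Yc r - Yc p) - (Xc r - Xc p) * (Yc q - Yc p).

Lemma areaE p q r : triangle_area R p q r = `|cross p q r|%:~R / 2.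
Proof. by rewrite /triangle_area /cross /Xc /Yc intr_norm rmorphB !rmorphM /= !rmorphB. Qed.

Lemma area_neq0 p q r : (triangle_area R p q r != 0) = (cross p q r != 0).
Proof. by rewrite areaE mulf_eq0 invr_eq0 (pnatr_eq0 R 2) orbF intr_eq0 normr_eq0. Qed.

Lemma area_half p q r : (triangle_area R p q r = 1 / 2) <-> `|cross p q r| = 1.
Proof.
rewrite areaE; split=> [/eqP|->//].
by rewrite (inj_eq (mulIf _)) ?invr_eq0 ?(pnatr_eq0 R 2) // -[1]/(1%:~R) eqr_int => /eqP.
Qed.

Lemma cross_swap12 (p q r : pt) : cross q p r = - cross p q r.
Proof. by rewrite /cross; lia. Qed.

Lemma cross_swap23 (p q r : pt) : cross p r q = - cross p q r.
Proof. by rewrite /cross; lia. Qed.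

Lemma cross_rot (p q r : pt) : cross q r p = cross p q r.
Proof. by rewrite /cross; lia. Qed.

Lemma cross_same13 (p q : pt) : cross p q p = 0.
Proof. by rewrite /cross !subrr mulr0 mul0r subr0. Qed.

Lemma cross_same23 (p q : pt) : cross p q q = 0.
Proof. by rewrite /cross mulrC subrr. Qed.

Lemma cross_uniq p q r : cross p q r != 0 -> [/\ p != q, p != r & q != r].
Proof.
by move=> d0; split; apply: contra_neqN d0 => /eqP ->; rewrite /cross; lia.
Qed.

Lemma sum_set3 (p q r : pt) (F : pt -> R) : [/\ p != q, p != r & q != r] ->
  \sum_(z in [set p; q; r]%SET) F z = F p + F q + F r.
Proof.
case=> pq pr qr; rewrite finset.setUC big_setU1 /=; last by rewrite !inE negb_or ![r == _]eq_sym pr.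
by rewrite big_setU1 ?inE //= big_set1 addrC.
Qed.

Lemma card_set3 (p q r : pt) : [/\ p != q, p != r & q != r] -> #|[set p; q; r]%SET| = 3.
Proof.
case=> pq pr qr.
by rewrite finset.setUC cardsU1 !inE negb_or ![r == _]eq_sym pr qr cards2 pq.
Qed.

Lemma set3P (Q : pt -> Prop) (a b c : pt) : Q a -> Q b -> Q c ->
  forall p, p \in [set a; b; c]%SET -> Q p.
Proof. by move=> ? ? ? p; rewrite !inE => /orP[/orP[]|] /eqP ->. Qed.

Lemma in_hull3 (p q r : pt) (a b c : R) (x : R * R) : cross p q r != 0 ->
  0 <= a -> 0 <= b -> 0 <= c -> a + b + c = 1 ->
  x.1 = a * (p.1 : nat)%:R + b * (q.1 : nat)%:R + c * (r.1 : nat)%:R ->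
  x.2 = a * (p.2 : nat)%:R + b * (q.2 : nat)%:R + c * (r.2 : nat)%:R ->
  hull [set p; q; r]%SET x.
Proof.
move=> /cross_uniq dd a0 b0 c0 abc x1 x2.
exists (fun z => if z == p then a else if z == q then b else c).
have [pq pr qr] := dd.
have E : (q == p = false) * (r == p = false) * (r == q = false).
  by rewrite ![r == _]eq_sym [q == p]eq_sym (negPf pq) (negPf pr) (negPf qr).
split; rewrite ?sum_set3 ?eqxx ?E //.
by apply: set3P; rewrite ?eqxx ?E.
Qed.

Lemma out_hull3 (p q r : pt) (x : R * R) : cross p q r != 0 ->
  hull [set p; q; r]%SET x -> exists a b c : R,
  [/\ [/\ 0 <= a, 0 <= b & 0 <= c], a + b + c = 1,
  x.1 = a * (p.1 : nat)%:R + b * (q.1 : nat)%:R + c * (r.1 : nat)%:R &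
  x.2 = a * (p.2 : nat)%:R + b * (q.2 : nat)%:R + c * (r.2 : nat)%:R].
Proof.
move=> /cross_uniq dd [w []]; rewrite !sum_set3 // => w0 w1 x1 x2.
by exists (w p), (w q), (w r); split=> //; split; apply: w0; rewrite !inE eqxx ?orbT.
Qed.

(** Cramer's rule for the barycentric coordinate at [z]. Evaluating it at a convex combination reads
    off the weight of [z], whence [comb_uniq]. *)
Lemma tri_coord (t : {set pt}) z : is_triangle R t -> z \in t ->
  exists a b c, aff a b c (crd z) = 1 /\
    forall z', z' \in t -> z' != z -> aff a b c (crd z') = 0.
Proof.
case=> p [q [r [-> ]]]; rewrite area_neq0 => d0 zt.
wlog -> : p q r d0 zt / z = p.
  move=> W; move: (zt); rewrite !inE => /orP[/orP[]|] /eqP zE.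
  - exact: W.
  - have /W : cross q p r != 0 by rewrite cross_swap12 oppr_eq0.
    by rewrite [[set q; p]%SET]finset.setUC; apply.
  - have /W : cross r p q != 0 by rewrite -cross_rot.
    by rewrite -finset.setUA finset.setUC; apply.
pose d : R := (cross p q r)%:~R.
have d0' : d != 0 by rewrite intr_eq0.
exists (((q.2 : nat)%:R - (r.2 : nat)%:R) / d), (((r.1 : nat)%:R - (q.1 : nat)%:R) / d),
  (((q.1 : nat)%:R * (r.2 : nat)%:R - (r.1 : nat)%:R * (q.2 : nat)%:R) / d).
have dE : d = ((q.1 : nat)%:R - (p.1 : nat)%:R) * ((r.2 : nat)%:R - (p.2 : nat)%:R)
   - ((r.1 : nat)%:R - (p.1 : nat)%:R) * ((q.2 : nat)%:R - (p.2 : nat)%:R).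
  by rewrite /d /cross /Xc /Yc rmorphB !rmorphM /= !rmorphB.
split; first by rewrite /aff /crd /= dE; field; rewrite -dE.
move=> z'; rewrite !inE => /orP[/orP[]|] /eqP -> ; rewrite ?eqxx // => _;
  by rewrite /aff /crd /=; field.
Qed.

Lemma comb_uniq t w w' x : is_triangle R t -> comb t w x -> comb t w' x ->
  forall z, z \in t -> w z = w' z.
Proof.
move=> tri wx wx' z zt; have [a [b [c [h1 h0]]]] := tri_coord tri zt.
have E v : comb t v x -> aff a b c x = v z.
  move=> vx; rewrite (comb_aff a b c vx) (bigD1 z) //= h1 mulr1 big1 ?addr0 // => p /andP[pt_ pz].
  by rewrite h0 ?mulr0.
by rewrite -(E _ wx) (E _ wx').
Qed.

(** The point lies in the hull of a common face [r], and by uniqueness of barycentric coordinates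
    its weights vanish on [s] outside [r]. All later uses of the face condition go through this
    lemma. *)
Lemma carrier (T : {set {set pt}}) s t w x : lattice_triangulation R T ->
  s \in T -> t \in T -> comb s w x -> hull t x ->
  forall z, z \in s -> w z != 0 -> z \in t.
Proof.
case=> tri _ face sT tT wx tx z zs wz.
have [r [rs rt E]] := face s t sT tT.
have [w' wx'] : hull r x by rewrite -E; split=> //; exists w.
have := comb_uniq (tri _ sT) wx (comb_extend rs wx') zs.
by case: ifP => [zr _|_ w0]; [exact: (fintype.subsetP rt)|rewrite w0 eqxx in wz].
Qed.

Lemma comb2 (t : {set pt}) (u v : pt) (l : R) : u \in t -> v \in t -> u != v ->
  0 <= l -> l <= 1 ->
  comb t (fun z => if z \in [set u; v]%SET then (if z == u then 1 - l else l) else 0)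
   ((1 - l) * (u.1 : nat)%:R + l * (v.1 : nat)%:R, (1 - l) * (u.2 : nat)%:R + l * (v.2 : nat)%:R).
Proof.
move=> ut vt uv l0 l1; apply: comb_extend.
  by apply/fintype.subsetP => z; rewrite !inE => /orP[] /eqP ->.
have vu : (v == u) = false by rewrite eq_sym (negPf uv).
have S (F : pt -> R) : \sum_(z in [set u; v]%SET) F z = F u + F v.
  by rewrite big_setU1 ?inE //= big_set1.
split; rewrite ?S ?eqxx ?vu //=; last by rewrite subrK.
by move=> p _; case: ifP => _ //; rewrite subr_ge0.
Qed.

Lemma card_triangle (t : {set pt}) : is_triangle R t -> #|t| = 3.
Proof.
by case=> p [q [r [-> ]]]; rewrite area_neq0 => /cross_uniq /card_set3.
Qed.

(* The barycenter of a triangle of [T'] lies in some triangle of [T]. *)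
Lemma maximal_triangulation (T T' : {set {set pt}}) :
  lattice_triangulation R T -> lattice_triangulation R T' -> T \subset T' -> T = T'.
Proof.
move=> hT hT' TT'; apply/eqP; rewrite finset.eqEsubset TT' /=; apply/fintype.subsetP => t tT'.
have [tri cov _] := hT; have [tri' cov' _] := hT'.
have /card_triangle t3 := tri' _ tT'.
pose x : R * R := (\sum_(p in t) 3^-1 * (p.1 : nat)%:R, \sum_(p in t) 3^-1 * (p.2 : nat)%:R).
have wx : comb t (fun=> 3^-1) x.
  by split=> [p _|||] //; rewrite ?invr_ge0 ?ler0n // sumr_const t3; field.
have : (\bigcup_(s in [set s | s \in T]) hull s) x.
  by rewrite cov -cov'; exists t => //; exists (fun=> 3^-1); exact: wx.
case=> s /= sT sx.
have ts : t \subset s.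
  by apply/fintype.subsetP => z zt; apply: (carrier hT' tT' (fintype.subsetP TT' _ sT) wx sx zt); rewrite invr_eq0 pnatr_eq0.
suff -> : t = s by [].
by apply/eqP; rewrite eqEcard ts t3 (card_triangle (tri _ sT)).
Qed.

End Geometry.

(** * Primitive triangles *)

(* [b] selects the left (false) or right (true) column. *)
HB.lock Definition outer (n : nat) (b : bool) (y : nat) : lattice_pt 2 n :=
  (inord (if b then 2 else 0), inord y).

HB.lock Definition mid (n : nat) (y : nat) : lattice_pt 2 n := (inord 1, inord y).

Section Strip.
Variables (R : realType) (n : nat).
Local Notation pt := (lattice_pt 2 n).
Local Notation hull := (conv_hull R).

Local Notation outer := (outer n).
Local Notation mid := (mid n).

Lemma outer1 b y : (outer b y).1 = (if b then 2 else 0)%N :> nat.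
Proof. by rewrite outer.unlock inordK //; case: b. Qed.
Lemma outer2 b y : (y <= n)%N -> (outer b y).2 = y :> nat.
Proof. by move=> yn; rewrite outer.unlock inordK. Qed.
Lemma mid1 y : (mid y).1 = 1 :> nat.
Proof. by rewrite mid.unlock inordK. Qed.
Lemma mid2 y : (y <= n)%N -> (mid y).2 = y :> nat.
Proof. by move=> yn; rewrite mid.unlock inordK. Qed.

Lemma Xc_outer b y : Xc (outer b y) = if b then 2 else 0.
Proof. by rewrite /Xc outer1; case: b. Qed.
Lemma Yc_outer b y : (y <= n)%N -> Yc (outer b y) = y.
Proof. by move=> yn; rewrite /Yc outer2. Qed.
Lemma Xc_mid y : Xc (mid y) = 1.
Proof. by rewrite /Xc mid1. Qed.
Lemma Yc_mid y : (y <= n)%N -> Yc (mid y) = y.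
Proof. by move=> yn; rewrite /Yc mid2. Qed.

Lemma ptP (p : pt) : (exists b y, (y <= n)%N /\ p = outer b y) \/ (exists y, (y <= n)%N /\ p = mid y).
Proof.
case: p => [[x ltx] [y lty]]; have yn : (y <= n)%N by [].
case: x ltx => [|[|[|//]]] ltx; [left; exists false, y|right; exists y|left; exists true, y];
  by rewrite ?outer.unlock ?mid.unlock; split=> //; congr pair; apply: val_inj; rewrite /= inordK.
Qed.

Lemma outer_inj b y b' y' : (y <= n)%N -> (y' <= n)%N -> outer b y = outer b' y' -> b = b' /\ y = y'.
Proof.
move=> yn yn' E; have := outer1 b y; have := outer2 b yn; rewrite E outer1 outer2 // => -> e.
by split=> //; move: e; case: b {E}; case: b'.
Qed.
Lemma mid_inj y y' : (y <= n)%N -> (y' <= n)%N -> mid y = mid y' -> y = y'.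
Proof. by move=> yn yn' E; have := mid2 yn; rewrite E mid2. Qed.
Lemma outer_mid b y y' : outer b y <> mid y'.
Proof. by move=> E; have := outer1 b y; rewrite E mid1; case: b {E}. Qed.

(* A: base on the middle column; B: base on an outer column; L: the two halves
   [up = false, true] of a parallelogram cut along an edge between the outer columns. *)
Definition Atri (b : bool) (a j : nat) : {set pt} := [set outer b a; mid j; mid j.+1]%SET.
Definition Btri (b : bool) (i c : nat) : {set pt} := [set outer b i; outer b i.+1; mid c]%SET.
Definition Ltri (b : bool) (a a' j : nat) (up : bool) : {set pt} :=
  [set outer b a; mid (j + up)%N; outer (~~ b) a']%SET.

Lemma LtriC b a a' j up : Ltri b a a' j up = Ltri (~~ b) a' a j up.
Proof. by rewrite /Ltri negbK finset.setUC finset.setUA [in LHS]finset.setUAC finset.setUC finset.setUA; congr (_ :|: _)%SET; rewrite finset.setUC. Qed.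

Lemma cross_A b a j : (a <= n)%N -> (j < n)%N -> `|cross (outer b a) (mid j) (mid j.+1)| = 1.
Proof.
by move=> an jn; rewrite /cross /Xc /Yc !mid1 !mid2 ?outer1 ?outer2 ?(ltnW jn) //; case: b; rewrite /=; lia.
Qed.
Lemma cross_B b i c : (i < n)%N -> (c <= n)%N -> `|cross (outer b i) (outer b i.+1) (mid c)| = 1.
Proof.
by move=> an jn; rewrite /cross /Xc /Yc !mid1 !mid2 ?outer1 ?outer2 ?(ltnW an) //; case: b; rewrite /=; lia.
Qed.
Lemma cross_L b a a' j (up : bool) : (a <= n)%N -> (a' <= n)%N -> (j < n)%N -> (a + a' = j.*2.+1)%N ->
  `|cross (outer b a) (mid (j + up)%N) (outer (~~ b) a')| = 1.
Proof.
move=> an an' jn E; have jn' : (j + up <= n)%N by case: (up); rewrite ?addn1 ?addn0 //; exact: ltnW.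
rewrite /cross /Xc /Yc !mid1 !mid2 ?outer1 ?outer2 //.
by case: b; case: up {jn'} => /=; rewrite ?addn1 ?addn0; lia.
Qed.

Definition primitive_form (t : {set pt}) : Prop :=
  [\/ exists b a j, [/\ (a <= n)%N, (j < n)%N & t = Atri b a j],
      exists b i c, [/\ (i < n)%N, (c <= n)%N & t = Btri b i c] |
      exists a a' j up, [/\ (a <= n)%N, (a' <= n)%N, (j < n)%N, (a + a' = j.*2.+1)%N & t = Ltri false a a' j up]].

(** After sorting by columns, the determinant is 0 for three vertices in one column, the distance of
    two vertices in one column if the third is in an adjacent column, and twice that distance if it
    is in the opposite one. With one vertex in each column it is y1 + y3 - 2 y2 up to sign. *)
Lemma primitive_formP (p q r : pt) : `|cross p q r| = 1 -> primitive_form [set p; q; r]%SET.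
Proof.
wlog : p q r / (p.1 <= q.1)%N.
  move=> W; case: (leqP p.1 q.1) => [|/ltnW]; first exact: W.
  by move=> /W W' d; rewrite [[set p; q]%SET]finset.setUC; apply: W'; rewrite cross_swap12 normrN.
wlog : p q r / (q.1 <= r.1)%N.
  move=> W pq; case: (leqP q.1 r.1) => [|qr]; first by move/W; apply.
  have [pr|rp] := leqP p.1 r.1.
    by rewrite finset.setUAC => d; apply: (W p r q (ltnW qr) pr); rewrite cross_swap23 normrN.
  rewrite finset.setUC finset.setUA => d.
  by apply: (W r p q pq (ltnW rp)); rewrite -cross_rot.
case: (ptP p) => [[b1 [y1 [h1 ->]]]|[y1 [h1 ->]]];
case: (ptP q) => [[b2 [y2 [h2 ->]]]|[y2 [h2 ->]]];
case: (ptP r) => [[b3 [y3 [h3 ->]]]|[y3 [h3 ->]]];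
rewrite /cross /Xc /Yc ?mid1 ?mid2 ?outer1 ?outer2 //.
- by case: b1; case: b2; case: b3 => //=; lia.
- case: b1; case: b2 => //= _ _ d; apply: Or32.
  have [E|E] : y2 = y1.+1 \/ y1 = y2.+1 by lia.
    by exists false, y1, y3; split; rewrite /Btri -?E.
  by exists false, y2, y3; split; rewrite /Btri -?E // [[set outer false y1; _]%SET]finset.setUC.
- case: b1; case: b3 => //= _ _ d; apply: Or33.
  have [E|E] : (y1 + y3 = y2.*2.+1 \/ y1 + y3 + 1 = y2.*2)%N by lia.
    by exists y1, y3, y2, false; split; rewrite /Ltri ?addn0 //; lia.
  (* The middle vertex is now the upper end of the crossed unit segment. *)
  exists y1, y3, y2.-1, true; split; rewrite /Ltri ?addn1 ?prednK //; lia.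
- case: b1 => //= _ _ d; apply: Or31.
  have [E|E] : y3 = y2.+1 \/ y2 = y3.+1 by lia.
    by exists false, y1, y2; split; rewrite /Atri -?E.
  by exists false, y1, y3; split; rewrite /Atri -?E // finset.setUAC.
- case: b2; case: b3 => //= _ _ d; apply: Or32.
  have [E|E] : y3 = y2.+1 \/ y2 = y3.+1 by lia.
    by exists true, y2, y1; split; rewrite /Btri -?E // -finset.setUA finset.setUC.
  by exists true, y3, y1; split; rewrite /Btri -?E // -finset.setUA finset.setUC [[set outer true y2; _]%SET]finset.setUC.
- by case: b2.
- case: b3 => //= _ _ d; apply: Or31.
  have [E|E] : y2 = y1.+1 \/ y1 = y2.+1 by lia.
    by exists true, y3, y1; split; rewrite /Atri -?E // finset.setUC finset.setUA.
  by exists true, y3, y2; split; rewrite /Atri -?E // finset.setUC [[set mid y1; _]%SET]finset.setUC finset.setUA.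
- by move=> _ _; lia.
Qed.

(** * Separation of two triangles by a line *)

Definition face_compat (s t : {set pt}) := hull s `&` hull t `<=` hull (s :&: t)%SET.

Lemma face_compatC s t : face_compat s t -> face_compat t s.
Proof. by rewrite /face_compat finset.setIC setIC. Qed.

Lemma face_compat_refl s : face_compat s s.
Proof. by rewrite /face_compat finset.setIid setIid. Qed.

(** Reflected so that column [b] is at abscissa 0; one computation then serves both strips. *)
Definition Xs (b : bool) (p : pt) : int := if b then 2 - Xc p else Xc p.
Definition lin (b : bool) (k l m : int) (p : pt) : int := k * Xs b p + l * Yc p + m.

(** A common point lies on the separating line, so both of its combinations are supported on [u] and
    [v]. Coordinates on the segment are unique, hence the two weight functions agree and vanish
    outside [s :&: t]. The points [u] and [v] may fail to be vertices, so a line with one relevant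
    point is covered too. *)
Lemma face_compat_sep (b : bool) (k l m : int) (u v : pt) (s t : {set pt}) :
  u != v ->
  (forall p, p \in s -> lin b k l m p <= 0 /\ (lin b k l m p = 0 -> p = u \/ p = v)) ->
  (forall p, p \in t -> 0 <= lin b k l m p /\ (lin b k l m p = 0 -> p = u \/ p = v)) ->
  face_compat s t.
Proof.
move=> uv hs ht x [[w wx] [w' wx']].
(* These coefficients undo the reflection of [Xs]: k (2 - x) + m = - k x + (m + 2 k). *)
pose k' := if b then - k else k; pose m' := if b then m + 2 * k else m.
pose A := aff (R := R) k'%:~R l%:~R m'%:~R.
have AE p : A (crd R p) = (lin b k l m p)%:~R.
  rewrite /A /aff /crd /lin /Xs /Xc /Yc /k' /m' /=.
  by case: (b); rewrite !(rmorphD, rmorphM, rmorphN, rmorphB) /=; ring.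
have As : A x = \sum_(p in s) w p * (lin b k l m p)%:~R.
  by rewrite /A (comb_aff _ _ _ wx); apply: eq_bigr => p _; rewrite -AE.
have At : A x = \sum_(p in t) w' p * (lin b k l m p)%:~R.
  by rewrite /A (comb_aff _ _ _ wx'); apply: eq_bigr => p _; rewrite -AE.
have [w_ge0 w1 _ _] := wx; have [w'_ge0 w'1 _ _] := wx'.
have A0 : A x = 0.
  apply/eqP; rewrite eq_le; apply/andP; split.
    rewrite As; apply: sumr_le0 => p ps; apply: mulr_ge0_le0; first exact: w_ge0.
    by rewrite lerz0; case: (hs p ps).
  rewrite At; apply: sumr_ge0 => p ps; apply: mulr_ge0; first exact: w'_ge0.
  by rewrite ler0z; case: (ht p ps).
have supp_s p : p \in s -> p \notin [set u; v]%SET -> w p = 0.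
  move=> ps; apply: contraNeq => wp; have [le0 z] := hs p ps.
  rewrite !inE; apply/orP; suff lin0 : lin b k l m p = 0 by case: (z lin0) => ->; rewrite eqxx; [left|right].
  have /eqP : \sum_(p in s) w p * - (lin b k l m p)%:~R = 0.
    by under eq_bigr => q _ do rewrite mulrN; rewrite sumrN -As A0 oppr0.
  rewrite psumr_eq0; last by move=> q qs; rewrite mulr_ge0 ?w_ge0 // oppr_ge0 lerz0; case: (hs q qs).
  move/allP => /(_ p); rewrite mem_index_enum ps => /(_ isT) /=.
  by rewrite mulf_eq0 (negPf wp) oppr_eq0 intr_eq0 => /eqP.
have supp_t p : p \in t -> p \notin [set u; v]%SET -> w' p = 0.
  move=> ps; apply: contraNeq => wp; have [le0 z] := ht p ps.
  rewrite !inE; apply/orP; suff lin0 : lin b k l m p = 0 by case: (z lin0) => ->; rewrite eqxx; [left|right].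
  have /eqP : \sum_(p in t) w' p * (lin b k l m p)%:~R = 0 by rewrite -At.
  rewrite psumr_eq0; last by move=> q qs; rewrite mulr_ge0 ?w'_ge0 // ler0z; case: (ht q qs).
  move/allP => /(_ p); rewrite mem_index_enum ps => /(_ isT) /=.
  by rewrite mulf_eq0 (negPf wp) intr_eq0 => /eqP.
have ws : comb (s :&: [set u; v])%SET w x.
  apply: comb_restrict wx => [|p ps]; first exact: subsetIl.
  by rewrite inE ps; exact: supp_s.
have wt : comb (t :&: [set u; v])%SET w' x.
  apply: comb_restrict wx' => [|p ps]; first exact: subsetIl.
  by rewrite inE ps; exact: supp_t.
have sub2 (r : {set pt}) : (r :&: [set u; v])%SET \subset [set u; v]%SET by exact: subsetIr.
have Ws := comb_extend (sub2 s) ws; have Wt := comb_extend (sub2 t) wt.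
set W := (fun p => _) in Ws; set W' := (fun p => _) in Wt.
have S (F : pt -> R) : \sum_(z in [set u; v]%SET) F z = F u + F v.
  by rewrite big_setU1 ?inE //= big_set1.
have WE : W u = W' u /\ W v = W' v.
  case: Ws => _; rewrite !S => s1 sx sy; case: Wt => _; rewrite !S => t1 tx ty.
  suff E : W u = W' u by split=> //; apply: (addrI (W u)); rewrite s1 E t1.
  apply/eqP; rewrite -subr_eq0; apply: contraTT uv => E; rewrite negbK.
  have sv : W v = 1 - W u by rewrite -s1 addrAC subrr add0r.
  have tv : W' v = 1 - W' u by rewrite -t1 addrAC subrr add0r.
  have e1 : (W u - W' u) * ((u.1 : nat)%:R - (v.1 : nat)%:R) = 0.
    have : x.1 - x.1 = 0 by rewrite subrr.
    by rewrite {1}sx tx sv tv => <-; ring.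
  have e2 : (W u - W' u) * ((u.2 : nat)%:R - (v.2 : nat)%:R) = 0.
    have : x.2 - x.2 = 0 by rewrite subrr.
    by rewrite {1}sy ty sv tv => <-; ring.
  move/eqP: e1; move/eqP: e2; rewrite !mulf_eq0 (negPf E) /= !subr_eq0 !eqr_nat.
  move=> /eqP e2 /eqP e1; apply/eqP; rewrite [u]surjective_pairing [v]surjective_pairing.
  by congr pair; apply: val_inj.
exists (fun p => if p \in (s :&: [set u; v])%SET then w p else 0).
have sub : (s :&: t :&: [set u; v])%SET \subset (s :&: t)%SET by exact: subsetIl.
apply: (comb_restrict _ _ (comb_extend (subsetIl s [set u; v]%SET) ws)); first exact: subsetIl.
move=> p ps; rewrite !inE ps /= => pt_; case: ifP => // puv.
have : W p = W' p by case/orP: puv => /eqP ->; case: WE.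
by rewrite /W /W' !inE ps (negPf pt_) puv.
Qed.

End Strip.

(** * The triangulation of a profile *)

Section Build.
Variables (R : realType) (n : nat).
Local Notation pt := (lattice_pt 2 n).
Local Notation hull := (conv_hull R).
Local Notation outer := (outer n).
Local Notation mid := (mid n).
Local Notation Atri := (Atri n).
Local Notation Btri := (Btri n).
Local Notation Ltri := (Ltri n).

(* [prof b j] is the height of the apex in column [b] over the [j]-th unit
   segment of the middle column, and [fl j] tells whether that segment is
   flipped to an edge between the outer columns. *)
Variables (prof : bool -> nat -> nat) (fl : nat -> bool).

Record valid_profile : Prop := ValidProfile {
  prof_le : forall b j, (j < n)%N -> (prof b j <= n)%N;
  prof_mono : forall b i j, (i <= j)%N -> (j < n)%N -> (prof b i <= prof b j)%N;
  prof_flip : forall j, (j < n)%N -> fl j -> (prof false j + prof true j = j.*2.+1)%N }.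

(** The edges crossing the strip next to column [b] form a lattice path in the pairs (a, c) from (0,
    0) to (n, n): passing a middle unit segment raises [c], passing an outer one raises [a]. This
    says that (a, c) is on the path. *)
Definition on_path b a c : Prop :=
  [/\ (a <= n)%N, (c <= n)%N, forall j, (j < c)%N -> (prof b j <= a)%N &
      forall j, (c <= j)%N -> (j < n)%N -> (a <= prof b j)%N].

(** The apex [c] in [TriB] is forced: it is the number of middle segments whose apex in column [b]
    has height at most [i]. *)
Inductive tri_of : {set pt} -> Prop :=
| TriA b j : (j < n)%N -> ~~ fl j -> tri_of (Atri b (prof b j) j)
| TriB b i c : (i < n)%N -> (c <= n)%N ->
    (forall j, (j < c)%N -> (prof b j <= i)%N) ->
    (forall j, (c <= j)%N -> (j < n)%N -> (i < prof b j)%N) -> tri_of (Btri b i c)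
| TriL j up : (j < n)%N -> fl j -> tri_of (Ltri false (prof false j) (prof true j) j up).

Hypothesis V : valid_profile.

Lemma prof_flipb b j : (j < n)%N -> fl j -> (prof b j + prof (~~ b) j = j.*2.+1)%N.
Proof. by move=> jn fj; have := prof_flip V jn fj; case: b => //; rewrite addnC. Qed.

Lemma TriLb b j up : (j < n)%N -> fl j -> tri_of (Ltri b (prof b j) (prof (~~ b) j) j up).
Proof. by move=> jn fj; case: b; [rewrite LtriC|]; exact: TriL. Qed.

(* A triangle [t] inside the strip next to column [b], with lower edge from
   [outer b a] to [mid c] and upper edge from [outer b a'] to [mid c']. *)
Variant strip b a c a' c' t : Prop :=
| StripA of (c < n)%N & ~~ fl c & prof b c = a & a' = a & c' = c.+1 & t = Atri b a c
| StripB of (a < n)%N & (c <= n)%N & (forall j, (j < c)%N -> (prof b j <= a)%N) &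
    (forall j, (c <= j)%N -> (j < n)%N -> (a < prof b j)%N) &
    a' = a.+1 & c' = c & t = Btri b a c.

Lemma tri_of_cases t : tri_of t ->
  (exists b a c a' c', strip b a c a' c' t) \/
  (exists j up, [/\ (j < n)%N, fl j & t = Ltri false (prof false j) (prof true j) j up]).
Proof.
case=> [b j jn fj|b i c i_n cn h1 h2|j up jn fj].
- by left; exists b, (prof b j), j, (prof b j), j.+1; exact: StripA.
- by left; exists b, i, c, i.+1, c; exact: StripB.
- by right; exists j, up.
Qed.

Lemma on_path_prof b j : (j < n)%N -> on_path b (prof b j) j /\ on_path b (prof b j) j.+1.
Proof.
move=> jn; have := prof_le V b jn; have m := @prof_mono V b => l; split; split=> //.
- exact: ltnW.
- by move=> i ij; apply: m => //; exact: ltnW.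
- by move=> i ij i_n; apply: m.
- by move=> i ij; apply: m => //; lia.
- by move=> i ij i_n; apply: m => //; exact: ltnW.
Qed.

(** If one coordinate decreased, the other would increase, and the profile at an index between the
    two would be at most the smaller and at least the larger outer height. *)
Lemma on_path_le b a c a' c' : on_path b a c -> on_path b a' c' ->
  (a + c <= a' + c')%N -> (a <= a')%N /\ (c <= c')%N.
Proof.
case=> an cn h1 h2 [an' cn' h1' h2'] le; split; rewrite leqNgt; apply/negP => lt.
- have cc : (c < c')%N by lia.
  by have := h1' c cc; have := h2 c (leqnn _); lia.
- have := h2' c' (leqnn _); have := h1 c' lt; lia.
Qed.

Lemma stripP b a c a' c' t : strip b a c a' c' t ->
  [/\ on_path b a c, on_path b a' c', (a' + c' = (a + c).+1)%N &
  forall p, p \in t -> exists2 y, (y <= n)%N &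
    (p = outer b y /\ (a <= y <= a')%N) \/ (p = mid y /\ (c <= y <= c')%N)].
Proof.
case=> [cn fc <- -> -> ->|an cn h1 h2 -> -> ->].
  have [q1 q2] := on_path_prof b cn; split=> //; first by rewrite addnS.
  have pn : (prof b c <= n)%N by exact: prof_le.
  apply: set3P; [exists (prof b c)|exists c|exists c.+1] => //; [left|exact: ltnW|right|right]; split=> //; lia.
split=> //; [split=> //; first exact: ltnW|split=> //|].
- by move=> j kj jn; have := h2 j kj jn; lia.
- by move=> j jk; have := h1 j jk; lia.
- apply: set3P; [exists a|exists a.+1|exists c] => //; [exact: ltnW|left|left|right]; split=> //; lia.
Qed.

Lemma lin_outer b k l m y : (y <= n)%N -> lin b k l m (outer b y) = l * y%:Z + m.
Proof. by move=> yn; rewrite /lin /Xs /Xc /Yc outer1 outer2 //; case: b => /=; lia. Qed.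
Lemma lin_opp b k l m y : (y <= n)%N -> lin b k l m (outer (~~ b) y) = k * 2 + l * y%:Z + m.
Proof. by move=> yn; rewrite /lin /Xs /Xc /Yc outer1 outer2 //; case: b => /=; lia. Qed.
Lemma lin_mid b k l m y : (y <= n)%N -> lin b k l m (mid y) = k + l * y%:Z + m.
Proof. by move=> yn; rewrite /lin /Xs /Xc /Yc mid1 mid2 //; case: b => /=; lia. Qed.

Lemma outer_mid_neq b y z : outer b y != mid z.
Proof. by apply/eqP; exact: outer_mid. Qed.

(** The side of the line through [outer b a] and [mid c], which meets the opposite column at height
    2c - a. Strictness there leaves only these two points on the line. *)
Definition below b a c (p : pt) := exists2 y, (y <= n)%N &
  [\/ p = outer b y /\ (y <= a)%N, p = mid y /\ (y <= c)%N |
      p = outer (~~ b) y /\ (y + a < c.*2)%N].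
Definition above b a c (p : pt) := exists2 y, (y <= n)%N &
  [\/ p = outer b y /\ (a <= y)%N, p = mid y /\ (c <= y)%N |
      p = outer (~~ b) y /\ (c.*2 < y + a)%N].

Lemma sep_edge b a c (s t : {set pt}) : (a <= n)%N -> (c <= n)%N ->
  (forall p, p \in s -> below b a c p) -> (forall p, p \in t -> above b a c p) ->
  face_compat R s t.
Proof.
move=> an cn hs ht.
apply: (@face_compat_sep R n b (a%:Z - c%:Z) 1 (- a%:Z) (outer b a) (mid c)).
- exact: outer_mid_neq.
- move=> p /hs [y yn [] [-> le]]; rewrite ?lin_outer ?lin_mid ?lin_opp //; split; try lia.
  + by move=> e; left; congr outer; lia.
  + by move=> e; right; congr mid; lia.
- move=> p /ht [y yn [] [-> le]]; rewrite ?lin_outer ?lin_mid ?lin_opp //; split; try lia.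
  + by move=> e; left; congr outer; lia.
  + by move=> e; right; congr mid; lia.
Qed.

Lemma strip_below b a c a' c' t u v : strip b a c a' c' t -> (a' <= u)%N -> (c' <= v)%N ->
  forall p, p \in t -> below b u v p.
Proof.
move=> /stripP[_ _ _ h] au cv p /h [y yn [[-> /andP[_ le]]|[-> /andP[_ le]]]]; exists y => //;
  by [apply: Or31; split=> //; exact: leq_trans au|apply: Or32; split=> //; exact: leq_trans cv].
Qed.

Lemma strip_above b a c a' c' t u v : strip b a c a' c' t -> (u <= a)%N -> (v <= c)%N ->
  forall p, p \in t -> above b u v p.
Proof.
move=> /stripP[_ _ _ h] au cv p /h [y yn [[-> /andP[le _]]|[-> /andP[le _]]]]; exists y => //;
  by [apply: Or31; split=> //; exact: leq_trans le|apply: Or32; split=> //; exact: leq_trans le].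
Qed.

Lemma long_above b j up : (j < n)%N -> fl j ->
  forall p, p \in Ltri b (prof b j) (prof (~~ b) j) j up -> above b (prof b j) j p.
Proof.
move=> jn fj; have e := prof_flipb b jn fj.
apply: set3P; [exists (prof b j)|exists (j + up)%N|exists (prof (~~ b) j)].
- exact: prof_le.
- by apply: Or31.
- by case: (up); rewrite ?addn1 ?addn0 //; exact: ltnW.
- by apply: Or32; rewrite leq_addr.
- exact: prof_le.
- by apply: Or33; split=> //; rewrite addnC e.
Qed.

Lemma long_below b j up : (j < n)%N -> fl j ->
  forall p, p \in Ltri b (prof b j) (prof (~~ b) j) j up -> below b (prof b j) j.+1 p.
Proof.
move=> jn fj; have e := prof_flipb b jn fj.
apply: set3P; [exists (prof b j)|exists (j + up)%N|exists (prof (~~ b) j)].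
- exact: prof_le.
- by apply: Or31.
- by case: (up); rewrite ?addn1 ?addn0 //; exact: ltnW.
- by apply: Or32; split=> //; case: (up); rewrite ?addn1 ?addn0.
- exact: prof_le.
- by apply: Or33; split=> //; rewrite addnC e.
Qed.

Lemma strip_same_low b a c a' c' s u v t :
  strip b a c a' c' s -> strip b a c u v t -> s = t.
Proof.
case=> [cn fc pc _ _ ->|an cn h1 h2 _ _ ->] []; rewrite // => *.
- have : (a < prof b c)%N by auto.
  by rewrite pc ltnn.
- have : (a < prof b c)%N by auto.
  by move=> ac; exfalso; lia.
Qed.

(** Each triangle is one step of the path. Two steps either start at the same edge, and then
    coincide, or are separated by the lower edge of the later one. *)
Lemma face_compat_strips b a c a' c' s u v u' v' t :
  strip b a c a' c' s -> strip b u v u' v' t -> face_compat R s t.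
Proof.
wlog le : a c a' c' s u v u' v' t / (a + c <= u + v)%N.
  move=> W S T; case: (leqP (a + c) (u + v)) => [le|/ltnW le]; first exact: W le S T.
  by apply: face_compatC; exact: W le T S.
move=> S T; have [q1 q2 e _] := stripP S; have [q3 q4 e' _] := stripP T.
have [E|lt] : (a + c = u + v \/ a' + c' <= u + v)%N by lia.
  have [au cv] := on_path_le q1 q3 le.
  have [Ea Ec] : a = u /\ c = v by lia.
  by rewrite Ea Ec in S; rewrite (strip_same_low S T); exact: face_compat_refl.
have [h1 h2] := on_path_le q2 q3 lt; have [un vn _ _] := q3.
by apply: (@sep_edge b u v) => //; [exact: strip_below S _ _|exact: strip_above T _ _].
Qed.

(** A flipped segment still takes the step from ([prof b j], j) to ([prof b j], j + 1) of the path,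
    so the order of edges applies again. No strip triangle starts at that lower edge: type A is
    excluded by the flip, type B by its strict inequality. *)
Lemma face_compat_strip_long b a c a' c' s j up :
  strip b a c a' c' s -> (j < n)%N -> fl j ->
  face_compat R s (Ltri b (prof b j) (prof (~~ b) j) j up).
Proof.
move=> S jn fj; have [q1 q2 e _] := stripP S; have [p1 p2] := on_path_prof b jn.
have pn := prof_le V b jn.
case: (ltngtP (a + c) (prof b j + j)) => [lt|gt|E].
- have [h1 h2] := @on_path_le b a' c' (prof b j) j q2 p1 ltac:(lia).
  apply: (@sep_edge b (prof b j) j) => //; [exact: ltnW|exact: strip_below S _ _|exact: long_above].
- have [h1 h2] := @on_path_le b (prof b j) j.+1 a c p2 q1 ltac:(lia).
  apply: face_compatC; apply: (@sep_edge b (prof b j) j.+1) => //; [exact: long_below|exact: strip_above S _ _].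
- have [h1 h2] := @on_path_le b (prof b j) j a c p1 q1 ltac:(lia).
  have [Ea Ec] : a = prof b j /\ c = j by lia.
  case: S => [cn fc _ _ _ _|an cn _ g2 _ _ _]; first by rewrite Ec fj in fc.
  by have := g2 j; rewrite Ec leqnn jn Ea ltnn => /(_ isT isT).
Qed.

Lemma face_compat_opposite b a c a' c' s u v u' v' t :
  strip b a c a' c' s -> strip (~~ b) u v u' v' t -> face_compat R s t.
Proof.
move=> S T.
have [[_ cn _ _] [_ cn' _ _] _ hs] := stripP S; have [[_ vn _ _] [_ vn' _ _] _ ht] := stripP T.
have cc : (c <= c' <= c.+1)%N by case: S => *; lia.
have vv : (v <= v' <= v.+1)%N by case: T => *; lia.
have [le|[le|[E [Ec Ev]]]] : (c' <= v)%N \/ (v' <= c)%N \/ c = v /\ c' = c.+1 /\ v' = v.+1 by lia.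
(* A nearly vertical line through [mid c']: the coefficient [n.+1] keeps the outer columns strictly
   on their sides, and the tilt separates the middle points below [c'] from those above. [outer b 0]
   merely fills the place of a second point. *)
- apply: (@face_compat_sep R n b n.+1 1 (- (n.+1 + c')%:Z) (mid c') (outer b 0)).
  + by rewrite eq_sym outer_mid_neq.
  + move=> p /hs[y yn [[-> /andP[y1 y2]]|[-> /andP[y1 y2]]]]; rewrite ?lin_outer ?lin_mid //; split; try lia.
    by move=> e; left; congr mid; lia.
  + move=> p /ht[y yn [[-> /andP[y1 y2]]|[-> /andP[y1 y2]]]]; rewrite ?lin_opp ?lin_mid //; split; try lia.
    by move=> e; left; congr mid; lia.
- apply: (@face_compat_sep R n b n.+1 (-1) (c%:Z - n.+1%:Z) (mid c) (outer b 0)).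
  + by rewrite eq_sym outer_mid_neq.
  + move=> p /hs[y yn [[-> /andP[y1 y2]]|[-> /andP[y1 y2]]]]; rewrite ?lin_outer ?lin_mid //; split; try lia.
    by move=> e; left; congr mid; lia.
  + move=> p /ht[y yn [[-> /andP[y1 y2]]|[-> /andP[y1 y2]]]]; rewrite ?lin_opp ?lin_mid //; split; try lia.
    by move=> e; left; congr mid; lia.
- rewrite -E Ev in ht *; rewrite Ec in hs cn'.
  have case2 y : (c <= y <= c.+1)%N -> mid y = mid c \/ mid y = mid c.+1.
    move=> cy; have [->|->] : y = c \/ y = c.+1 by lia.
    by left.
  by right.
  apply: (@face_compat_sep R n b 1 0 (-1) (mid c) (mid c.+1)).
  + by apply/eqP => /(mid_inj cn cn'); lia.
  + move=> p /hs[y yn [[-> y1]|[-> y1]]]; rewrite ?lin_outer ?lin_mid //; split; try lia.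
    by move=> _; exact: case2.
  + move=> p /ht[y yn [[-> y1]|[-> y1]]]; rewrite ?lin_opp ?lin_mid //; split; try lia.
    by move=> _; apply: case2; lia.
Qed.

Lemma face_compat_long_eq b j k up up' : (j < k)%N -> (k < n)%N -> fl j -> fl k ->
  prof b j = prof b k -> face_compat R (Ltri b (prof b j) (prof (~~ b) j) j up)
    (Ltri b (prof b k) (prof (~~ b) k) k up').
Proof.
move=> jk kn fj fk E; have jn := ltn_trans jk kn.
have ej := prof_flipb b jn fj; have ek := prof_flipb b kn fk.
apply: (@sep_edge b (prof b k) k); [exact: prof_le|exact: ltnW| |exact: long_above].
apply: set3P; [exists (prof b j)|exists (j + up)%N|exists (prof (~~ b) j)]; rewrite ?prof_le //.
- by apply: Or31; rewrite E.
- by case: (up); rewrite ?addn1 ?addn0 // ltnW.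
- by apply: Or32; split=> //; case: (up); rewrite ?addn1 ?addn0 // ltnW.
- by apply: Or33; split=> //; rewrite -E addnC ej ltn_Sdouble.
Qed.

Lemma face_compat_long j k up up' : (j < n)%N -> (k < n)%N -> fl j -> fl k ->
  face_compat R (Ltri false (prof false j) (prof true j) j up)
    (Ltri false (prof false k) (prof true k) k up').
Proof.
wlog jk : j k up up' / (j <= k)%N.
  move=> W jn kn fj fk; case: (leqP j k) => [le|/ltnW le]; first exact: W.
  by apply: face_compatC; apply: W.
move=> jn kn fj fk; have ej := prof_flip V jn fj; have ek := prof_flip V kn fk.
have [aj bj ak bk] : [/\ prof false j <= n, prof true j <= n, prof false k <= n & prof true k <= n]%N.
  by split; exact: prof_le.
move: jk; rewrite leq_eqVlt => /orP[/eqP E|jk].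
  subst k; wlog : up up' / (up <= up')%N.
    move=> W; case: (leqP up up') => [|/ltnW]; first exact: W.
    by move/W => H; exact: face_compatC.
  case: up up' => [] [] // _; rewrite /Ltri ?addn0 ?addn1; try exact: face_compat_refl.
  apply: (@face_compat_sep R n false ((prof false j)%:Z - (prof true j)%:Z) 2
    (- 2 * (prof false j)%:Z) (outer false (prof false j)) (outer true (prof true j))).
  - by apply/eqP => /(outer_inj aj bj)[].
  - apply: set3P; rewrite ?lin_outer ?lin_mid ?(@lin_opp false) // 1?ltnW //; split; try lia.
    + by left.
    + by right.
  - apply: set3P; rewrite ?lin_outer ?lin_mid ?(@lin_opp false) //; split; try lia.
    + by left.
    + by right.
have [E|ne] := eqVneq (prof false j) (prof false k); first exact: (@face_compat_long_eq false).
have [E|ne'] := eqVneq (prof true j) (prof true k).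
  by rewrite LtriC [Ltri _ (prof false k) _ _ _]LtriC; exact: (@face_compat_long_eq true).
have lt : (prof false j < prof false k)%N by rewrite ltn_neqAle ne prof_mono // ltnW.
have lt' : (prof true j < prof true k)%N by rewrite ltn_neqAle ne' prof_mono // ltnW.
(* The separating line through [mid k] is parallel to the long edge of [k]. *)
apply: (@face_compat_sep R n false ((prof false k)%:Z - (prof true k)%:Z) 2
  ((prof true k)%:Z - (prof false k)%:Z - 2 * k%:Z) (mid k) (outer false 0)).
- by rewrite eq_sym outer_mid_neq.
- have uj : (j + up <= k)%N by case: (up); rewrite ?addn1 ?addn0 // ltnW.
  have un := leq_trans uj (ltnW kn).
  apply: set3P; rewrite ?lin_outer ?lin_mid ?(@lin_opp false) //; try (split; lia).
  split; first lia.
  by move=> e; left; congr mid; lia.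
- have uk : (k + up' <= n)%N by case: (up'); rewrite ?addn1 ?addn0 // ltnW.
     apply: set3P; rewrite ?lin_outer ?lin_mid ?(@lin_opp false) //; try (split; lia).
  split; first lia.
  by move=> e; left; congr mid; lia.
Qed.

Lemma face_compat_tri s t : tri_of s -> tri_of t -> face_compat R s t.
Proof.
move=> /tri_of_cases[[b [a [c [a' [c' S]]]]]|[j [up [jn fj ->]]]] /tri_of_cases[[b' [u [v [u' [v' T]]]]]|[k [up' [kn fk ->]]]].
- have [E|E] : b' = b \/ b' = ~~ b by case: (b'); case: (b); auto.
    by rewrite E in T; exact: face_compat_strips S T.
  by rewrite E in T; exact: face_compat_opposite S T.
- case: b S => S; last exact: face_compat_strip_long S kn fk.
  by rewrite LtriC; exact: face_compat_strip_long S kn fk.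
- apply: face_compatC; case: b' T => T; last exact: face_compat_strip_long T jn fj.
  by rewrite LtriC; exact: face_compat_strip_long T jn fj.
- exact: face_compat_long.
Qed.

End Build.

(** * Covering of the rectangle *)

Section Build2.
Variables (R : realType) (n : nat).
Local Notation pt := (lattice_pt 2 n).
Local Notation hull := (conv_hull R).
Local Notation outer := (outer n).
Local Notation mid := (mid n).
Local Notation Atri := (Atri n).
Local Notation Btri := (Btri n).
Local Notation Ltri := (Ltri n).

Definition xi (b : bool) (x : R * R) : R := if b then 2 - x.1 else x.1.

Lemma cross_neq0 (p q r : pt) : `|cross p q r| = 1 -> cross p q r != 0.
Proof. by move=> h; apply/eqP => d0; rewrite d0 normr0 in h. Qed.

(** Here and below, [d] is the height of [x] above the lower edge of the triangle or parallelogram;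
    the bound on [d] is the vertical extent at abscissa [xi b x]. *)
Lemma A_hull b a j (x : R * R) (d : R) : (a <= n)%N -> (j < n)%N -> xi b x <= 1 ->
  x.2 = (1 - xi b x) * a%:R + xi b x * j%:R + d -> 0 <= d <= xi b x -> hull (Atri b a j) x.
Proof.
move=> an jn x1 y /andP[d0 dx].
apply: (@in_hull3 R n _ _ _ (1 - xi b x) (xi b x - d) d); first exact/cross_neq0/cross_A.
- lra.
- lra.
- lra.
- ring.
- by rewrite !mid1 outer1 /xi; case: (b) => /=; ring.
- by rewrite !mid2 ?outer2 ?(ltnW jn) // -natr1 y; ring.
Qed.

Lemma B_hull b i c (x : R * R) (d : R) : (i < n)%N -> (c <= n)%N -> 0 <= xi b x ->
  x.2 = (1 - xi b x) * i%:R + xi b x * c%:R + d -> 0 <= d <= 1 - xi b x -> hull (Btri b i c) x.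
Proof.
move=> i_n cn x1 y /andP[d0 dx].
apply: (@in_hull3 R n _ _ _ (1 - xi b x - d) d (xi b x)); first exact/cross_neq0/cross_B.
- lra.
- lra.
- lra.
- ring.
- by rewrite !mid1 !outer1 /xi; case: (b) => /=; ring.
- by rewrite !mid2 ?outer2 ?(ltnW i_n) // -natr1 y; ring.
Qed.

Lemma L_hull b a a' j (x : R * R) (d : R) : (a <= n)%N -> (a' <= n)%N -> (j < n)%N ->
  (a + a' = j.*2.+1)%N -> 0 <= xi b x <= 1 ->
  x.2 = (1 - xi b x) * a%:R + xi b x * j%:R + d -> 0 <= d <= xi b x ->
  exists up, hull (Ltri b a a' j up) x.
Proof.
move=> an an' jn E /andP[x0 x1] y /andP[d0 dx].
have a'E : a'%:R = 2 * j%:R + 1 - a%:R :> R.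
  have : (a + a')%N%:R = (j.*2.+1)%:R :> R by rewrite E.
  by rewrite natrD -natr1 -mul2n natrM => h; lra.
(* At this abscissa the long edge runs at height [xi b x / 2] above the lower edge. *)
have [le|gt] := leP d (xi b x / 2).
  exists false; apply: (@in_hull3 R n _ _ _ (1 - xi b x + d) (xi b x - 2 * d) d).
  - exact/cross_neq0/cross_L.
  - lra.
  - lra.
  - lra.
  - ring.
  - by rewrite !mid1 !outer1 /xi; case: (b) => /=; ring.
  - by rewrite addn0 !mid2 ?outer2 ?(ltnW jn) // a'E y; ring.
exists true; apply: (@in_hull3 R n _ _ _ (1 - d) (2 * d - xi b x) (xi b x - d)).
- exact/cross_neq0/cross_L.
- lra.
- lra.
- lra.
- ring.
- by rewrite !mid1 !outer1 /xi; case: (b) => /=; ring.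
- by rewrite addn1 !mid2 ?outer2 // -natr1 a'E y; ring.
Qed.

Variables (prof : bool -> nat -> nat) (fl : nat -> bool).
Local Notation tri_of := (@tri_of n prof fl).
Local Notation on_path := (on_path n prof).
Hypothesis V : valid_profile n prof fl.

Lemma on_path_step b a c : on_path b a c -> (a + c < n.*2)%N ->
  [/\ (c < n)%N, prof b c = a & on_path b a c.+1] \/
  [/\ (a < n)%N, forall j, (c <= j)%N -> (j < n)%N -> (a < prof b j)%N & on_path b a.+1 c].
Proof.
move=> P lt; have [an cn h1 h2] := P.
have [cn'|cn'] : (c < n)%N \/ c = n by lia.
  have [pc|pc] : prof b c = a \/ (a < prof b c)%N.
    by have := h2 c (leqnn c) cn'; rewrite leq_eqVlt => /orP[/eqP|]; auto.
    by left; split=> //; rewrite -pc; have [] := on_path_prof V b cn'.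
  have B j : (c <= j)%N -> (j < n)%N -> (a < prof b j)%N.
    by move=> cj jn; apply: leq_trans pc _; exact: (prof_mono V).
  right; split=> //; first by apply: leq_trans pc _; exact: (prof_le V).
  by split=> // [|j jc]; [apply: leq_trans pc _; exact: (prof_le V)|apply/ltnW/h1].
have B j : (c <= j)%N -> (j < n)%N -> (a < prof b j)%N by lia.
right; split=> //; first lia.
by split=> // [|j jc]; [lia|apply/ltnW/h1].
Qed.

(** Climb the path until the next edge is no longer below [x]; [m] counts the remaining steps. The
    climb stops because the last edge, from (n, n), is the top side of the rectangle. *)
Lemma cover b (x : R * R) m a c : on_path b a c -> (a + c + m = n.*2)%N -> (0 < m)%N ->
  0 <= xi b x <= 1 -> (1 - xi b x) * a%:R + xi b x * c%:R <= x.2 -> x.2 <= n%:R ->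
  exists2 t, tri_of t & hull t x.
Proof.
move=> + + + x01; have /andP[x0 x1] := x01.
elim: m a c => // m IH a c P E _ le ge; have [an cn h1 h2] := P.
set d := x.2 - ((1 - xi b x) * a%:R + xi b x * c%:R).
have dE : x.2 = (1 - xi b x) * a%:R + xi b x * c%:R + d by rewrite /d; ring.
have d0 : 0 <= d by rewrite subr_ge0.
have last a' c' : (a' + c' + m = n.*2)%N -> on_path b a' c' ->
    (1 - xi b x) * a'%:R + xi b x * c'%:R < x.2 -> exists2 t, tri_of t & hull t x.
  move=> E' P' lt; case: (posnP m) => [m0|m0]; last exact: IH P' E' m0 (ltW lt) ge.
  have [an' cn' _ _] := P'.
  have [ea ec] : a' = n /\ c' = n by lia.
  by exfalso; move: lt ge; rewrite ea ec; lra.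
have [|[cn' pc P']|[an' B P']] := on_path_step P; first lia.
  have [dx|dx] := leP d (xi b x).
    case F : (fl c).
      have [up hx] := @L_hull b a (prof (~~ b) c) c x d an (prof_le V _ cn') cn'
        ltac:(by rewrite -pc; exact: (prof_flipb V b cn' F)) x01 dE ltac:(by rewrite d0).
      by exists (Ltri b (prof b c) (prof (~~ b) c) c up); [exact: TriLb|rewrite pc].
    exists (Atri b (prof b c) c); first by apply: TriA => //; rewrite F.
    by rewrite pc; apply: A_hull dE _ => //; rewrite d0.
  by apply: last P' _; [lia|rewrite dE -natr1; lra].
have [dx|dx] := leP d (1 - xi b x).
  exists (Btri b a c); first exact: TriB.
  by apply: B_hull dE _ => //; rewrite d0.
by apply: last P' _; [lia|rewrite dE -natr1; lra].
Qed.

Lemma rectangle_hull (t : {set pt}) : hull t `<=` rectangle R 2 n.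
Proof.
move=> x [w [w0 w1 x1 x2]]; rewrite /rectangle /= x1 x2; split; apply/andP; split.
- by apply: sumr_ge0 => p pt_; rewrite mulr_ge0 ?w0.
- apply: (@le_trans _ _ ((\sum_(p in t) w p) * 2%:R)); last by rewrite w1 mul1r.
  rewrite mulr_suml; apply: ler_sum => p pt_.
  by rewrite ler_wpM2l ?w0 // ler_nat -ltnS ltn_ord.
- by apply: sumr_ge0 => p pt_; rewrite mulr_ge0 ?w0.
- apply: (@le_trans _ _ ((\sum_(p in t) w p) * n%:R)); last by rewrite w1 mul1r.
  rewrite mulr_suml; apply: ler_sum => p pt_.
  by rewrite ler_wpM2l ?w0 // ler_nat -ltnS ltn_ord.
Qed.

Lemma tri_of_form t : tri_of t -> exists p q r, t = [set p; q; r]%SET /\ `|cross p q r| = 1.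
Proof.
case=> [b j jn fj|b i c i_n cn _ _|j up jn fj]; do 3!eexists; split; try reflexivity.
- by apply: cross_A => //; exact: (prof_le V).
- exact: cross_B.
- by apply: cross_L; rewrite ?(prof_le V) ?(prof_flip V).
Qed.

Definition build : {set {set pt}} := [set t | `[< tri_of t >]]%SET.

Lemma buildP t : t \in build <-> tri_of t.
Proof. by rewrite inE; split=> /asboolP. Qed.

Lemma cross_set3 (p q r a b c : pt) : [set p; q; r]%SET = [set a; b; c]%SET ->
  `|cross a b c| = 1 -> `|cross p q r| = 1.
Proof.
move=> E d1; have [ab ac bc] := cross_uniq (cross_neq0 d1).
have c3 : #|[set p; q; r]%SET| = 3 by rewrite E card_set3.
have [pq pr qr] : [/\ p != q, p != r & q != r].
  move: c3; rewrite finset.setUC cardsU1 !inE negb_or cards2 ![r == _]eq_sym.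
  by case: (p == q) => //; case: (p == r) => //; case: (q == r).
have mem z : z \in [set a; b; c]%SET -> z = a \/ z = b \/ z = c.
  by rewrite !inE => /orP[/orP[]|] /eqP ->; auto.
have := mem p; rewrite -E !inE eqxx => /(_ isT) Hp.
have := mem q; rewrite -E !inE eqxx orbT => /(_ isT) Hq.
have := mem r; rewrite -E !inE eqxx orbT => /(_ isT) Hr.
have Ns : [/\ `|cross b a c| = 1, `|cross a c b| = 1, `|cross b c a| = 1, `|cross c a b| = 1 & `|cross c b a| = 1].
  by split; rewrite -d1 /cross; lia.
case: Ns => *.
by case: Hp => [|[]] ep; case: Hq => [|[]] eq_; case: Hr => [|[]] er; subst;
  rewrite ?eqxx in pq pr qr.
Qed.

Lemma build_triangulation : (0 < n)%N -> primitive_triangulation R build.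
Proof.
move=> n0; split; last first.
  move=> p q r /buildP /tri_of_form[a [b [c [E d1]]]].
  by apply/area_half; exact: cross_set3 E d1.
split.
- move=> t /buildP /tri_of_form[a [b [c [E d1]]]]; exists a, b, c; split=> //.
  by rewrite area_neq0 cross_neq0.
- apply/seteqP; split=> [x [t _]|x [/andP[x0 x2] /andP[y0 yn]]]; first exact: rectangle_hull.
  have [b xb] : exists b, 0 <= xi b x <= 1.
    have [le|gt] := leP x.1 1; first by exists false; rewrite /xi x0.
    by exists true; rewrite /xi; lra.
  have P0 : on_path b 0 0 by split=> // j _; exact: (prof_le V).
  have n2 : (0 < n.*2)%N by rewrite double_gt0.
  have le0 : (1 - xi b x) * 0%:R + xi b x * 0%:R <= x.2 by rewrite !mulr0 addr0.
  have [t tt tx] := cover P0 (add0n _) n2 xb le0 yn.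
  by exists t => //=; apply/buildP.
- move=> s t /buildP S /buildP T; exists (s :&: t)%SET; rewrite subsetIl subsetIr; split=> //.
  apply/seteqP; split; first exact: face_compat_tri S T.
  by move=> x hx; split; apply: hull_sub hx; rewrite ?subsetIl ?subsetIr.
Qed.

End Build2.

(** * The profile of a triangulation *)

Section Extract.
Variables (R : realType) (n : nat).
Local Notation pt := (lattice_pt 2 n).
Local Notation hull := (conv_hull R).
Local Notation outer := (outer n).
Local Notation mid := (mid n).
Local Notation Atri := (Atri n).
Local Notation Btri := (Btri n).
Local Notation Ltri := (Ltri n).
Variable T : {set {set pt}}.
Hypothesis hT : primitive_triangulation R T.

(** The signs say that the segments cross in their interiors. By [carrier] at the crossing point,
    [u] and [v] are vertices of [t], so [t] consists of [u], [v] and [u'], and [v'] cannot be on the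
    other side of the line through [u] and [v]. *)
Lemma no_crossing (s t : {set pt}) (u v u' v' : pt) : s \in T -> t \in T ->
  u \in s -> v \in s -> u' \in t -> v' \in t ->
  0 < cross u v u' -> cross u v v' < 0 -> cross u' v' u < 0 -> 0 < cross u' v' v -> False.
Proof.
move=> sT tT us vs u't v't D1 D2 E1 E2.
have uv : u != v by apply: contraTneq D1 => ->; rewrite /cross; lia.
have u'v' : u' != v' by apply: contraTneq E2 => ->; rewrite /cross; lia.
have := E1; have := E2; have := D1; have := D2.
rewrite -(ltr_int R) -(ltr0z R) -(ltr0z R) -(ltr_int R).
set d1 := (cross u v u')%:~R; set d2 := (cross u v v')%:~R.
set e1 := (cross u' v' u)%:~R; set e2 := (cross u' v' v)%:~R => d2n d1p e2p e1n.
(* The parameters at which the signed areas, affine along each segment, vanish. *)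
pose l : R := - e1 / (e2 - e1); pose m : R := d1 / (d1 - d2).
have e0 : 0 < e2 - e1 by lra.
have d0 : 0 < d1 - d2 by lra.
have l0 : 0 < l by rewrite divr_gt0 // oppr_gt0.
have l1 : l < 1 by rewrite ltr_pdivrMr // mul1r; lra.
have m0 : 0 < m by rewrite divr_gt0.
have m1 : m < 1 by rewrite ltr_pdivrMr // mul1r; lra.
have ws := comb2 us vs uv (ltW l0) (ltW l1).
have wt := comb2 u't v't u'v' (ltW m0) (ltW m1).
have dE (p q r : pt) : (cross p q r)%:~R = ((q.1 : nat)%:R - (p.1 : nat)%:R) * ((r.2 : nat)%:R - (p.2 : nat)%:R)
   - ((r.1 : nat)%:R - (p.1 : nat)%:R) * ((q.2 : nat)%:R - (p.2 : nat)%:R) :> R.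
  by rewrite /cross /Xc /Yc rmorphB !rmorphM /= !rmorphB.
have E : ((1 - l) * (u.1 : nat)%:R + l * (v.1 : nat)%:R, (1 - l) * (u.2 : nat)%:R + l * (v.2 : nat)%:R)
   = ((1 - m) * (u'.1 : nat)%:R + m * (v'.1 : nat)%:R, (1 - m) * (u'.2 : nat)%:R + m * (v'.2 : nat)%:R).
  have dd : d1 - d2 = e2 - e1 by rewrite /e1 /e2 /d1 /d2 !dE; ring.
  have lD : l * (e2 - e1) = - e1 by rewrite divfK // lt0r_neq0.
  have mD : m * (e2 - e1) = d1 by rewrite /m dd divfK // lt0r_neq0.
  have key (p q p' q' : R) : e2 * p - e1 * q = (e2 - e1 - d1) * p' + d1 * q' ->
      (1 - l) * p + l * q = (1 - m) * p' + m * q'.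
    move=> h; apply: (mulIf (lt0r_neq0 e0)).
    have -> : ((1 - l) * p + l * q) * (e2 - e1) =
        (e2 - e1 - l * (e2 - e1)) * p + l * (e2 - e1) * q by ring.
    have -> : ((1 - m) * p' + m * q') * (e2 - e1) =
        (e2 - e1 - m * (e2 - e1)) * p' + m * (e2 - e1) * q' by ring.
    by rewrite lD mD opprK subrK mulNr.
  by congr pair; apply: key; rewrite /e1 /e2 /d1 !dE; ring.
have mem z : z \in s -> (z == u) || (z == v) -> z \in t.
  move=> zs zuv; have wt' : hull t ((1 - l) * (u.1 : nat)%:R + l * (v.1 : nat)%:R, (1 - l) * (u.2 : nat)%:R + l * (v.2 : nat)%:R).
    by rewrite E; eexists; exact: wt.
  apply: (carrier hT.1 sT tT ws wt' zs); rewrite !inE zuv.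
  by case: ifP => _; apply: lt0r_neq0; rewrite ?subr_gt0.
have ut : u \in t by apply: mem; rewrite ?eqxx.
have vt : v \in t by apply: mem; rewrite ?eqxx ?orbT.
have [tri _ _] := hT.1.
have te : t = [set u; v; u']%SET.
  apply/eqP; rewrite eq_sym eqEcard (card_triangle (tri _ tT)).
  rewrite card_set3 ?andbT; last by apply/cross_uniq/lt0r_neq0.
  by apply/fintype.subsetP => z; rewrite !inE => /orP[/orP[]|] /eqP ->.
move: v't; rewrite te !inE => /orP[/orP[]|] /eqP ve; move: D2; rewrite ve.
- by rewrite cross_same13.
- by rewrite cross_same23.
- by move/(lt_trans D1); rewrite ltxx.
Qed.

Lemma form_of t : t \in T -> primitive_form t.
Proof.
have [[tri _ _] prim] := hT.
move=> tT; have [p [q [r [E _]]]] := tri t tT.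
by rewrite E; apply: primitive_formP; apply/(area_half R); apply: prim; rewrite -E.
Qed.

Lemma no_strip_crossing b s t a c a' c' : s \in T -> t \in T ->
  outer b a \in s -> mid c \in s -> outer b a' \in t -> mid c' \in t ->
  (a' <= n)%N -> (c <= n)%N -> (a < a')%N -> (c' < c)%N -> False.
Proof.
move=> sT tT h1 h2 h3 h4 an cn aa cc.
have an' : (a <= n)%N by lia.
have cn' : (c' <= n)%N by lia.
by case: b h1 h3 => h1 h3; [apply: (no_crossing sT tT h2 h1 h3 h4)|apply: (no_crossing sT tT h1 h2 h3 h4)];
  rewrite /cross ?Xc_outer ?Yc_outer ?Xc_mid ?Yc_mid //=; lia.
Qed.

(** The long edge meets the middle column at height j + 1/2, so an edge that starts above it in
    column [b] and ends at [mid c] with [c <= j] crosses it. *)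
Lemma no_long_crossing b s t a a' j i c : s \in T -> t \in T ->
  outer b a \in s -> outer (~~ b) a' \in s -> outer b i \in t -> mid c \in t ->
  (a' <= n)%N -> (i <= n)%N -> (c <= n)%N -> (a + a' = j.*2.+1)%N -> (a < i)%N -> (c <= j)%N -> False.
Proof.
move=> sT tT h1 h2 h3 h4 an i_n cn E ai cj.
have an' : (a <= n)%N by lia.
by case: b h1 h2 h3 => h1 h2 h3; [apply: (no_crossing sT tT h2 h1 h3 h4)|apply: (no_crossing sT tT h1 h2 h3 h4)];
  rewrite /cross ?Xc_outer ?Yc_outer ?Xc_mid ?Yc_mid //=; lia.
Qed.

Lemma Atri_uniq b a a' j : (a <= n)%N -> (a' <= n)%N -> (j < n)%N ->
  Atri b a j \in T -> Atri b a' j \in T -> a = a'.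
Proof.
move=> an an' jn h h'; case: (ltngtP a a') => // lt; exfalso.
- by apply: (@no_strip_crossing b _ _ a j.+1 a' j h h'); rewrite // !inE eqxx ?orbT.
- by apply: (@no_strip_crossing b _ _ a' j.+1 a j h' h); rewrite // !inE eqxx ?orbT.
Qed.

(** The given point is the midpoint of the long edge, so both ends have positive weight. *)
Lemma long_carrier a a' j up t : (a <= n)%N -> (a' <= n)%N -> (j < n)%N -> (a + a' = j.*2.+1)%N ->
  Ltri false a a' j up \in T -> t \in T -> hull t (1, j%:R + 1 / 2) ->
  outer false a \in t /\ outer true a' \in t.
Proof.
move=> an an' jn E sT tT ht.
have us : outer false a \in Ltri false a a' j up by rewrite !inE eqxx.
have vs : outer true a' \in Ltri false a a' j up by rewrite !inE eqxx ?orbT.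
have uv : outer false a != outer true a' by apply/eqP => /(outer_inj an an')[].
have h2 : 0 <= 1 / 2 :> R by lra.
have h21 : 1 / 2 <= 1 :> R by lra.
have := comb2 us vs uv h2 h21; rewrite !outer1 !outer2 //=.
have a'E : a'%:R = 2 * j%:R + 1 - a%:R :> R.
  have : (a + a')%N%:R = (j.*2.+1)%:R :> R by rewrite E.
  by rewrite natrD -natr1 -mul2n natrM => h; lra.
have -> : ((1 - 1 / 2) * 0 + 1 / 2 * 2, (1 - 1 / 2) * a%:R + 1 / 2 * a'%:R) = (1, j%:R + 1 / 2) :> R * R.
  by rewrite a'E; congr pair; field.
move=> ws; split; apply: (carrier hT.1 sT tT ws ht) => //; rewrite !inE eqxx ?orbT /=.
  by apply: lt0r_neq0; lra.
by case: ifP => _; apply: lt0r_neq0; lra.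
Qed.

Lemma hull_A_mid b a j : (j < n)%N -> hull (Atri b a j) (1, j%:R + 1 / 2).
Proof.
move=> jn; have us : mid j \in Atri b a j by rewrite !inE eqxx ?orbT.
have vs : mid j.+1 \in Atri b a j by rewrite !inE eqxx ?orbT.
have uv : mid j != mid j.+1 by apply/eqP => /(mid_inj (ltnW jn) jn); lia.
have h2 : 0 <= 1 / 2 :> R by lra.
have h21 : 1 / 2 <= 1 :> R by lra.
have := comb2 us vs uv h2 h21; rewrite !mid1 !mid2 ?(ltnW jn) //=.
have -> : ((1 - 1 / 2) * 1 + 1 / 2 * 1, (1 - 1 / 2) * j%:R + 1 / 2 * j.+1%:R) = (1, j%:R + 1 / 2) :> R * R.
  by rewrite -natr1; congr pair; field.
by move=> ws; eexists; exact: ws.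
Qed.

Lemma hull_L_mid a a' j up : (a <= n)%N -> (a' <= n)%N -> (j < n)%N -> (a + a' = j.*2.+1)%N ->
  hull (Ltri false a a' j up) (1, j%:R + 1 / 2).
Proof.
move=> an an' jn E.
have us : outer false a \in Ltri false a a' j up by rewrite !inE eqxx.
have vs : outer true a' \in Ltri false a a' j up by rewrite !inE eqxx ?orbT.
have uv : outer false a != outer true a' by apply/eqP => /(outer_inj an an')[].
have h2 : 0 <= 1 / 2 :> R by lra.
have h21 : 1 / 2 <= 1 :> R by lra.
have := comb2 us vs uv h2 h21; rewrite !outer1 !outer2 //=.
have a'E : a'%:R = 2 * j%:R + 1 - a%:R :> R.
  have : (a + a')%N%:R = (j.*2.+1)%:R :> R by rewrite E.
  by rewrite natrD -natr1 -mul2n natrM => h; lra.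
have -> : ((1 - 1 / 2) * 0 + 1 / 2 * 2, (1 - 1 / 2) * a%:R + 1 / 2 * a'%:R) = (1, j%:R + 1 / 2) :> R * R.
  by rewrite a'E; congr pair; field.
by move=> ws; eexists; exact: ws.
Qed.

Lemma outer_in_A b a j c b' : (a <= n)%N -> (c <= n)%N -> outer b c \in Atri b' a j -> b = b'.
Proof.
move=> an cn; rewrite !inE -orbA => /or3P[] /eqP; first by case/outer_inj.
- by move/outer_mid.
- by move/outer_mid.
Qed.

Lemma outer_in_L b a a' j up c : (a <= n)%N -> (a' <= n)%N -> (c <= n)%N ->
  outer b c \in Ltri false a a' j up -> c = if b then a' else a.
Proof.
move=> an an' cn; rewrite !inE -orbA => /or3P[] /eqP; try by move/outer_mid.
- by case/outer_inj => // -> ->.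
- by case/outer_inj => // -> ->.
Qed.

Lemma long_not_A a a' j up b c : (a <= n)%N -> (a' <= n)%N -> (j < n)%N -> (a + a' = j.*2.+1)%N -> (c <= n)%N ->
  Ltri false a a' j up \in T -> Atri b c j \in T -> False.
Proof.
move=> an an' jn E cn LT AT.
have [/(outer_in_A cn an) e1 /(outer_in_A cn an') e2] := long_carrier an an' jn E LT AT (hull_A_mid b c jn).
by rewrite -e1 in e2.
Qed.

Lemma long_uniq a a' j up c c' up' : (a <= n)%N -> (a' <= n)%N -> (j < n)%N -> (a + a' = j.*2.+1)%N ->
  (c <= n)%N -> (c' <= n)%N -> (c + c' = j.*2.+1)%N ->
  Ltri false a a' j up \in T -> Ltri false c c' j up' \in T -> a = c /\ a' = c'.
Proof.
move=> an an' jn E cn cn' E' LT LT'.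
by have [/(outer_in_L cn cn' an) -> /(outer_in_L cn cn' an') ->] :=
  long_carrier an an' jn E LT LT' (hull_L_mid up' cn cn' jn E').
Qed.

(* The triangle is found at height [j + 1/4], just inside the strip next to column
   [b]: no other triangle meets this point if the distance to the middle column
   is less than [1 / (4 n)]. *)
Lemma apex_exists b j : (j < n)%N -> exists2 a, (a <= n)%N & Atri b a j \in T \/
  exists2 a', (a' <= n)%N & (a + a' = j.*2.+1)%N /\ Ltri b a a' j false \in T.
Proof.
move=> jn; pose e : R := (4 * (n%:R + 1))^-1.
have n0 : 0 <= n%:R :> R by [].
have n1 : 0 < 4 * (n%:R + 1) :> R by lra.
have e0 : 0 < e by rewrite invr_gt0.
have en : e * n%:R < 1 / 4.
  have : e * (4 * (n%:R + 1)) = 1 by rewrite mulVf // lt0r_neq0.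
  lra.
have ea a : (a <= n)%N -> 0 <= e * a%:R /\ e * a%:R < 1 / 4.
  move=> an; split; first by rewrite mulr_ge0 // ltW.
  by apply: le_lt_trans en; rewrite ler_pM2l // ler_nat.
have e1 : e <= 1 / 4.
  have : e * (4 * (n%:R + 1)) = 1 by rewrite mulVf // lt0r_neq0.
  have : 0 <= e * n%:R by rewrite mulr_ge0 // ltW.
  lra.
(* The height 1/4 rather than 1/2 avoids the long edge and selects the lower half of a
   parallelogram. *)
pose x : R * R := (if b then 1 + e else 1 - e, j%:R + 1 / 4).
have jn' : (j%:R + 1 <= n%:R :> R) by rewrite natr1 ler_nat.
have [[_ cov _] _] := hT.
have : (\bigcup_(t in [set t | t \in T]) hull t) x.
  rewrite cov; split; rewrite /x /=; last by rewrite addr_ge0 //=; lra.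
  by case: (b); lra.
case=> t /= tT; case: (form_of tT) => [[b' [a [k [an kn E]]]]|[b' [i [k [i_n kn E]]]]|[a [a' [k [up [an an' kn aa E]]]]]].
- rewrite E => /out_hull3[|w0 [w1 [w2 [[w0p w1p w2p] w1E]]]]; first exact/cross_neq0/cross_A.
  rewrite !mid1 !mid2 ?outer1 ?outer2 ?(ltnW kn) //= -[k.+1%:R]natr1 => X Y.
  have bb : b' = b by move: X; case: (b'); case: (b) => // X; exfalso; lra.
  have w0E : w0 = e by move: X; rewrite bb; case: (b); lra.
  have w1E' : w1 = 1 - e - w2 by lra.
  have [ea0 ea1] := ea _ an; have [ek0 ek1] := ea _ (ltnW kn).
  move: Y; rewrite w0E w1E' => Y.
  have kj : k = j.
    case: (ltngtP k j) => // lt; exfalso.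
      have : k%:R + 1 <= j%:R :> R by rewrite natr1 ler_nat.
      lra.
    have : j%:R + 1 <= k%:R :> R by rewrite natr1 ler_nat.
    lra.
  by exists a => //; left; rewrite -kj -bb -E.
- rewrite E => /out_hull3[|w0 [w1 [w2 [[w0p w1p w2p] w1E]]]]; first exact/cross_neq0/cross_B.
  rewrite !mid1 !mid2 ?outer1 ?outer2 ?(ltnW i_n) //= -[i.+1%:R]natr1 => X Y; exfalso.
  have w2E : w2 = 1 - e by move: X; case: (b'); case: (b); lra.
  have w1E' : w1 = e - w0 by lra.
  have [ea0 ea1] := ea _ (ltnW i_n); have [ek0 ek1] := ea _ kn.
  move: Y; rewrite w1E' w2E => Y.
  case: (leqP k j) => lt.
    have : k%:R <= j%:R :> R by rewrite ler_nat.
    have : e * (i%:R + 1) < 1 / 4 by rewrite natr1; case: (ea _ i_n).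
    have : 0 <= w0 <= e by lra.
    lra.
  have : j%:R + 1 <= k%:R :> R by rewrite natr1 ler_nat.
  lra.
- wlog [c [c' [cn cn' cc {}E]]] : / exists c c', [/\ (c <= n)%N, (c' <= n)%N, (c + c' = k.*2.+1)%N & t = Ltri b c c' k up].
    by apply; case: (b); [exists a', a; rewrite E LtriC addnC|exists a, a'; rewrite E].
  rewrite E => /out_hull3[|w0 [w1 [w2 [[w0p w1p w2p] w1E]]]]; first exact/cross_neq0/cross_L.
  have kup : (k + up <= n)%N by case: (up); rewrite ?addn1 ?addn0 // ltnW.
  rewrite !mid1 !mid2 ?outer1 ?outer2 //= => X Y.
  have w0E : w0 = e + w2 by move: X; case: (b) => /=; lra.
  have w1E' : w1 = 1 - e - 2 * w2 by lra.
  have c'E : c'%:R = 2 * k%:R + 1 - c%:R :> R.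
    have : (c + c')%N%:R = (k.*2.+1)%:R :> R by rewrite cc.
    by rewrite natrD -natr1 -mul2n natrM => h; lra.
  have [ea0 ea1] := ea _ cn; have [ek0 ek1] := ea _ (ltnW kn).
  move: Y; rewrite w0E w1E' c'E natrD => Y.
  case: up E kup Y => /= E kup Y.
    exfalso; have ek2 : e * (k%:R + 1) < 1 / 4 by rewrite natr1; case: (ea _ kn).
    case: (leqP j k) => lt.
      have : j%:R <= k%:R :> R by rewrite ler_nat.
      lra.
    have : k%:R + 1 <= j%:R :> R by rewrite natr1 ler_nat.
    lra.
  have kj : k = j.
    case: (ltngtP k j) => // lt; exfalso.
      have : k%:R + 1 <= j%:R :> R by rewrite natr1 ler_nat.
      lra.
    have : j%:R + 1 <= k%:R :> R by rewrite natr1 ler_nat.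
    lra.
  by exists c => //; right; exists c'; rewrite // -kj -E.
Qed.

End Extract.

(** * Bijection between profiles and triangulations *)

Section Profile.
Variables (R : realType) (n : nat).
Local Notation pt := (lattice_pt 2 n).
Local Notation outer := (outer n).
Local Notation mid := (mid n).
Local Notation Atri := (Atri n).
Local Notation Btri := (Btri n).
Local Notation Ltri := (Ltri n).
Local Notation build := (build n).

Lemma build_inj (prof prof' : bool -> nat -> nat) (fl fl' : nat -> bool) : (0 < n)%N ->
  valid_profile n prof fl -> valid_profile n prof' fl' -> build prof fl = build prof' fl' ->
  forall j, (j < n)%N -> (forall b, prof b j = prof' b j) /\ fl j = fl' j.
Proof.
move=> n0 V V' E j jn.
have hT := @build_triangulation R n prof fl V n0.
have pl b := prof_le V b jn; have pl' b := prof_le V' b jn.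
have tA b : ~~ fl j -> Atri b (prof b j) j \in build prof fl by move=> h; apply/buildP/TriA.
have tA' b : ~~ fl' j -> Atri b (prof' b j) j \in build prof fl by move=> h; rewrite E; apply/buildP/TriA.
have tL : fl j -> Ltri false (prof false j) (prof true j) j false \in build prof fl.
  by move=> h; apply/buildP/TriL.
have tL' : fl' j -> Ltri false (prof' false j) (prof' true j) j false \in build prof fl.
  by move=> h; rewrite E; apply/buildP/TriL.
case F : (fl j); case F' : (fl' j).
- have [||e1 e2] := long_uniq hT (pl false) (pl true) jn _ (pl' false) (pl' true) _ (tL F) (tL' F').
  + exact: (prof_flip V jn F).
  + exact: (prof_flip V' jn F').
  + by split=> // - [].
- by exfalso; apply: (long_not_A hT (pl false) (pl true) jn (prof_flip V jn F) (pl' false) (tL F)); apply: tA'; rewrite F'.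
- by exfalso; apply: (long_not_A hT (pl' false) (pl' true) jn (prof_flip V' jn F') (pl false) (tL' F')); apply: tA; rewrite F.
- by split=> // b; apply: (Atri_uniq hT (pl b) (pl' b) jn); [apply: tA; rewrite F|apply: tA'; rewrite F'].
Qed.

Lemma build_surj (T : {set {set pt}}) : (0 < n)%N -> primitive_triangulation R T ->
  exists prof fl, valid_profile n prof fl /\ T = build prof fl.
Proof.
move=> n0 hT.
have ex j : exists g : nat * nat * bool, (j < n)%N -> [/\ (g.1.1 <= n)%N, (g.1.2 <= n)%N &
    if g.2 then (g.1.1 + g.1.2 = j.*2.+1)%N /\ Ltri false g.1.1 g.1.2 j false \in T
    else Atri false g.1.1 j \in T /\ Atri true g.1.2 j \in T].
  have [jn|] := ltnP j n; last by exists (0, 0, false).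
  (* A long triangle found from either side supplies both apexes; the segment is unflipped only if
     both sides show a triangle based on it. *)
  have [a an [At|[a' an' [E Lt]]]] := apex_exists hT false jn; last by exists (a, a', true).
  have [c cn [Ct|[c' cn' [E Lt]]]] := apex_exists hT true jn; first by exists (a, c, false).
  by exists (c', c, true) => _; split=> //=; split; [rewrite addnC|rewrite LtriC].
have [g hg] := choice ex.
pose prof b j := if b then (g j).1.2 else (g j).1.1; pose fl j := (g j).2.
have pl b j : (j < n)%N -> (prof b j <= n)%N by move=> jn; case: (hg j jn); case: b.
have tA b j : (j < n)%N -> ~~ fl j -> Atri b (prof b j) j \in T.
  by move=> jn; rewrite /fl /prof; case: (hg j jn) => _ _; case: (g j).2 => // -[]; case: b.
have tL j : (j < n)%N -> fl j -> (prof false j + prof true j = j.*2.+1)%N /\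
     Ltri false (prof false j) (prof true j) j false \in T.
  by move=> jn; rewrite /fl /prof; case: (hg j jn) => _ _; case: (g j).2.
have low b j : (j < n)%N -> exists2 t, t \in T & outer b (prof b j) \in t /\ mid j \in t.
  move=> jn; case F : (fl j).
    exists (Ltri false (prof false j) (prof true j) j false); first by case: (tL _ jn F).
    by rewrite !inE addn0; case: b; rewrite !eqxx ?orbT.
  by exists (Atri b (prof b j) j); [apply: tA; rewrite ?F|rewrite !inE !eqxx ?orbT].
have V : valid_profile n prof fl.
  split=> [//|b i j ij jn|j jn fj]; last by case: (tL _ jn fj).
  rewrite leqNgt; apply/negP => lt.
  have ij' : (i < j)%N.
    by rewrite ltn_neqAle ij andbT; apply: contraTneq lt => ->; rewrite ltnn.
  have i_n := ltn_trans ij' jn.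
  have [s sT [s1 s2]] := low b i i_n; have [t tT [t1 t2]] := low b j jn.
  exact: (no_strip_crossing hT tT sT t1 t2 s1 s2 (pl b i i_n) (ltnW jn) lt ij').
exists prof, fl; split=> //.
have [hB _] := @build_triangulation R n prof fl V n0.
apply: (maximal_triangulation hT.1 hB); apply/fintype.subsetP => t tT; apply/buildP.
have [[b [a [k [an kn E]]]]|[b [i [c [i_n cn E]]]]|[a [a' [k [up [an an' kn aa E]]]]]] := form_of hT tT.
- rewrite E in tT *; case F : (fl k).
    have [e L] := tL k kn F.
    by exfalso; exact: (long_not_A hT (pl false k kn) (pl true k kn) kn e an L tT).
  have fk : ~~ fl k by rewrite F.
  by rewrite (Atri_uniq hT an (pl b k kn) kn tT (tA b k kn fk)); exact: TriA.
- have m1 : outer b i \in t by rewrite E !inE eqxx.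
  have m2 : outer b i.+1 \in t by rewrite E !inE eqxx orbT.
  have m3 : mid c \in t by rewrite E !inE eqxx !orbT.
  rewrite E; apply: TriB => // j jc.
    rewrite leqNgt; apply/negP => lt; have jn := leq_trans jc cn.
    have [s sT [s1 s2]] := low b j jn.
    exact: (no_strip_crossing hT tT sT m1 m3 s1 s2 (pl b j jn) cn lt jc).
  move=> jn; rewrite ltnNge; apply/negP => le.
  (* A contradicting edge must end at a middle point above [c], and [c = j] is possible. An
     unflipped segment has the edge to [mid j.+1]; for a flipped one only the lower half is
     recorded, and its long edge is used instead. *)
  case F : (fl j).
    have [e L] := tL j jn F.
    have e' : (prof b j + prof (~~ b) j = j.*2.+1)%N by case: (b); rewrite // addnC.
    have s1 c' : outer c' (prof c' j) \in Ltri false (prof false j) (prof true j) j false.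
      by case: c'; rewrite !inE eqxx ?orbT.
    by apply: (no_long_crossing hT L tT (s1 b) (s1 (~~ b)) m2 m3 (pl _ j jn) i_n cn e').
  have fj : ~~ fl j by rewrite F.
  have s1 : outer b (prof b j) \in Atri b (prof b j) j by rewrite !inE eqxx.
  have s2 : mid j.+1 \in Atri b (prof b j) j by rewrite !inE eqxx orbT.
  exact: (no_strip_crossing hT (tA b j jn fj) tT s1 s2 m2 m3 i_n jn).
- rewrite E in tT *; case F : (fl k).
    have [e L] := tL k kn F.
    have [-> ->] := long_uniq hT an an' kn aa (pl false k kn) (pl true k kn) e tT L.
    exact: TriL.
  have fk : ~~ fl k by rewrite F.
  by exfalso; exact: (long_not_A hT an an' kn aa (pl false k kn) tT (tA false k kn fk)).
Qed.

End Profile.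

(** * Enumeration of the profiles *)

Definition flags p q k := if (p + q == k.*2.+1)%N then [:: false; true] else [:: false].

Definition conf_tops k p q : seq (nat * nat * bool) :=
  [seq (xy, e) | xy <- [seq (x, y) | x <- iota 0 p.+1, y <- iota 0 q.+1],
                 e <- flags xy.1 xy.2 k].

(* An entry of a profile is (left height, right height, flip flag). *)
Fixpoint confs k p q : seq (seq (nat * nat * bool)) :=
  if k is k'.+1 then
    [seq rcons d xe | xe <- conf_tops k' p q, d <- confs k' xe.1.1 xe.1.2]
  else [:: [::]].

Lemma confsS k p q :
  confs k.+1 p q = [seq rcons d xe | xe <- conf_tops k p q, d <- confs k xe.1.1 xe.1.2].
Proof. by []. Qed.

Definition conf_prof (d : seq (nat * nat * bool)) (b : bool) j :=
  let x := nth (0, 0, false)%N d j in if b then x.1.2 else x.1.1.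
Definition conf_flip (d : seq (nat * nat * bool)) j := (nth (0, 0, false)%N d j).2.

Lemma size_confs k p q : size (confs k p q) = nconf k p q.
Proof.
elim: k p q => // k IH p q; rewrite confsS.
rewrite size_allpairs_dep sumnE big_map big_allpairs_dep big_allpairs_dep.
rewrite -[iota 0 p.+1]/(index_iota 0 p.+1) big_mkord; apply: eq_bigr => x _.
rewrite -[iota 0 q.+1]/(index_iota 0 q.+1) big_mkord; apply: eq_bigr => y _.
rewrite /flags; case: eqP => _; rewrite !big_cons !big_nil /= !IH addn0.
  by rewrite addnn -mul2n.
by rewrite mul1n.
Qed.

Lemma uniq_confs k p q : uniq (confs k p q).
Proof.
elim: k p q => // k IH p q.
rewrite confsS; apply: allpairs_uniq_dep => [|xe _|]; first last.
- by move=> [xe d] [xe' d'] _ _ /= /rcons_inj[-> ->].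
- exact: IH.
apply: allpairs_uniq_dep => [|xy _|[xy e] [xy' e'] _ _ /= [-> ->] //]; last first.
  by rewrite /flags; case: ifP.
apply: allpairs_uniq; rewrite ?(iota_uniq 0 p.+1) ?(iota_uniq 0 q.+1) //.
by move=> [x y] [x' y'] _ _ /= [-> ->].
Qed.

Definition conf_ok k p q d : Prop :=
  [/\ size d = k, forall j, (j < k)%N -> (conf_prof d false j <= p)%N /\ (conf_prof d true j <= q)%N,
    forall b i j, (i <= j)%N -> (j < k)%N -> (conf_prof d b i <= conf_prof d b j)%N &
    forall j, (j < k)%N -> conf_flip d j -> (conf_prof d false j + conf_prof d true j = j.*2.+1)%N].

Lemma conf_ok_rcons k p q d x y e : conf_ok k.+1 p q (rcons d (x, y, e)) <->
  [/\ (x <= p)%N, (y <= q)%N, e -> (x + y = k.*2.+1)%N & conf_ok k x y d].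
Proof.
have nthd j : size d = k -> (j < k)%N -> nth (0, 0, false)%N (rcons d (x, y, e)) j = nth (0, 0, false)%N d j.
  by move=> sd jk; rewrite nth_rcons sd jk.
have nthk : size d = k -> nth (0, 0, false)%N (rcons d (x, y, e)) k = (x, y, e).
  by move=> sd; rewrite nth_rcons sd ltnn eqxx.
split=> [[]|[xp yq E [sd le mono flip]]].
  rewrite size_rcons => -[sd] le mono flip.
  have [] := le k (ltnSn k); rewrite /conf_prof nthk //= => xp yq; split=> //.
    by have := flip k (ltnSn k); rewrite /conf_flip /conf_prof nthk.
  split=> // [j jk|b i j ij jk|j jk].
  - have := mono false j k (ltnW jk) (ltnSn k); have := mono true j k (ltnW jk) (ltnSn k).
    by rewrite /conf_prof nthk // nthd.
  - have := mono b i j ij (ltnW jk); rewrite /conf_prof !nthd //.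
    exact: leq_ltn_trans jk.
  - by have := flip j (ltnW jk); rewrite /conf_flip /conf_prof nthd.
have cases j : (j < k.+1)%N -> (j < k)%N \/ j = k by lia.
split=> [|j /cases[jk| ->]|b i j ij /cases[jk|jk]|j /cases[jk| ->]].
- by rewrite size_rcons sd.
- rewrite /conf_prof nthd //; have [h1 h2] := le j jk.
  by split; [exact: leq_trans h1 xp|exact: leq_trans h2 yq].
- by rewrite /conf_prof nthk.
- rewrite /conf_prof !nthd //; first exact: mono.
  exact: leq_ltn_trans jk.
- rewrite /conf_prof jk nthk //; move: ij; rewrite jk leq_eqVlt => /orP[/eqP ->|ik]; first by rewrite nthk.
  by rewrite nthd //; have [h1 h2] := le i ik; case: (b).
- by rewrite /conf_flip /conf_prof nthd //; exact: flip.
- by rewrite /conf_flip /conf_prof nthk.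
Qed.

Lemma confsP k p q d : reflect (conf_ok k p q d) (d \in confs k p q).
Proof.
apply: (iffP idP); elim: k p q d => [|k IH] p q d.
- by rewrite inE => /eqP ->; split.
- rewrite confsS => /allpairsPdep[[[x y] e] [d' [/allpairsPdep[xy [e' [hxy he [-> ->]]]] hd ->]]].
  move: hxy he hd => /allpairsP[[x' y'] /= [hx hy ->]] /= he hd.
  apply/conf_ok_rcons; split; last exact: IH.
  + by move: hx; rewrite (mem_iota 0 p.+1).
  + by move: hy; rewrite (mem_iota 0 q.+1).
  + by move: he; rewrite /flags; case: eqP => // _; rewrite inE => /eqP ->.
- by case=> /size0nil ->.
case/lastP: d => [|d [[x y] e]]; first by case.
move/conf_ok_rcons => [xp yq E ok]; apply/allpairsPdep; exists (x, y, e), d; split=> //; last exact: IH.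
apply/allpairsPdep; exists (x, y), e; split=> //.
  by apply/allpairsP; exists (x, y); rewrite /= (mem_iota 0 p.+1) (mem_iota 0 q.+1).
by rewrite /flags; case: eqP; case: (e) E => //; rewrite !inE // => + ne => /(_ isT).
Qed.

Lemma f2E (R : realType) n : (0 < n)%N -> f R 2 n = nconf n n n.
Proof.
move=> n0; rewrite -size_confs /f.
pose F d := build n (conf_prof d) (conf_flip d).
have V d : d \in confs n n n -> valid_profile n (conf_prof d) (conf_flip d).
  by case/confsP => _ le mono flip; split=> // -[] j jn; case: (le j jn).
have uF : uniq (map F (confs n n n)).
  rewrite map_inj_in_uniq ?uniq_confs // => d d' hd hd' E.
  have H := build_inj R n0 (V d hd) (V d' hd') E.
  case/confsP: hd => sd _ _ _; case/confsP: hd' => sd' _ _ _.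
  apply: (@eq_from_nth _ (0, 0, false)%N); first by rewrite sd sd'.
  move=> j; rewrite sd => /H[]; rewrite /conf_prof /conf_flip.
  case: (nth _ d j) => [[x y] e]; case: (nth _ d' j) => [[x' y'] e'] /= h ->.
  by have := h false; have := h true => /= -> ->.
rewrite -(size_map F) -(card_uniqP uF); apply: eq_card => T; rewrite inE.
apply/asboolP/mapP => [hT|[d hd ->]]; last exact: build_triangulation (V d hd) n0.
have [prof [fl [VP ->]]] := build_surj n0 hT.
pose d := mkseq (fun j => (prof false j, prof true j, fl j)) n.
have nd j : (j < n)%N -> nth (0, 0, false)%N d j = (prof false j, prof true j, fl j).
  by move=> jn; rewrite nth_mkseq.
have pd b j : (j < n)%N -> conf_prof d b j = prof b j.
  by move=> jn; rewrite /conf_prof nd //; case: b.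
have fd j : (j < n)%N -> conf_flip d j = fl j by move=> jn; rewrite /conf_flip nd.
have hd : d \in confs n n n.
  apply/confsP; split=> [|j jn|b i j ij jn|j jn]; first by rewrite size_mkseq.
  - by rewrite !pd //; split; exact: (prof_le VP).
  - by rewrite !pd ?(leq_ltn_trans ij) //; exact: (prof_mono VP).
  - by rewrite !pd // fd //; exact: (prof_flip VP).
(* The two profiles agree only at indices below [n], so the sets are compared triangle by triangle;
   by maximality one inclusion is enough. *)
exists d => //; have [h1 _] := @build_triangulation R n _ _ VP n0.
have [h2 _] := @build_triangulation R n _ _ (V d hd) n0.
apply: (maximal_triangulation h1 h2); apply/fintype.subsetP => t /buildP tt; apply/buildP.
case: tt => [b j jn fj|b i c i_n cn g1 g2|j up jn fj].
- by rewrite -(pd b j jn); apply: TriA; rewrite ?fd.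
- apply: TriB => // j jc; first by rewrite pd ?g1 // (leq_trans jc).
  by move=> jn; rewrite pd ?g2.
- by rewrite -!(pd _ j jn); apply: TriL; rewrite ?fd.
Qed.

(** * Central binomial series *)

Definition cbin k := 'C(k.*2, k).

Lemma cbinS k : (k.+1 * cbin k.+1 = (4 * k + 2) * cbin k)%N.
Proof.
have h1 := mul_bin_diag k.+1.*2 k; have h2 := mul_bin_diag k.*2.+1 k.
rewrite doubleS /= in h1 h2.
have h3 : 'C(k.*2.+1, k) = 'C(k.*2.+1, k.+1) by rewrite -bin_sub; [congr 'C(_, _)|]; lia.
by rewrite /cbin doubleS -h1 h3 -[k.*2.+2]/(k.+1.*2) -mul2n -mulnA -h2; lia.
Qed.

(** Symmetry evaluates the sum weighted by [k]; combined with the recurrence [cbinS] this gives (n +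
    1) S(n + 1) = 4 (n + 1) S(n). *)
Lemma cbin_conv n : \sum_(k < n.+1) cbin k * cbin (n - k) = (4 ^ n)%N.
Proof.
pose S n := (\sum_(k < n.+1) cbin k * cbin (n - k))%N.
have sym m : (2 * \sum_(k < m.+1) k * (cbin k * cbin (m - k)) = m * S m)%N.
  rewrite mul2n -addnn [X in (X + _)%N](reindex_inj rev_ord_inj) /= -big_split /= /S big_distrr /=.
  apply: eq_bigr => k _; have := ltn_ord k; rewrite ltnS subSS => km.
  by rewrite subKn // [(cbin (m - k) * _)%N]mulnC -mulnDl subnK.
rewrite -/(S n); elim: n => [|n IH]; first by rewrite /S big_ord1.
have := sym n.+1; rewrite big_ord_recl mul0n add0n.
under eq_bigr => k _ do rewrite lift0 subSS mulnA cbinS -mulnA.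
have -> : (\sum_(k < n.+1) (4 * k + 2) * (cbin k * cbin (n - k)) = 2 * (n * S n) + 2 * S n)%N.
  rewrite -sym /S !big_distrr -big_split /=; apply: eq_bigr => k _ /=; lia.
rewrite expnS -IH => E; apply/eqP; rewrite -(eqn_pmul2l (ltn0Sn n)) -E; apply/eqP; lia.
Qed.

Lemma cbin_le4 k : (cbin k.+1 <= 4 * cbin k)%N.
Proof. by rewrite -(leq_pmul2l (ltn0Sn k)) cbinS; lia. Qed.

Section CentralBinomialSeries.
Variable R : realType.
Implicit Types x y : R.

Definition cbps x N : R := \sum_(i < N) (cbin i)%:R * x ^+ i.

Lemma sum_antidiag (F : nat -> nat -> R) N :
  \sum_(m < N) \sum_(i < m.+1) F i (m - i)%N = \sum_(i < N) \sum_(j < N - i) F i j.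
Proof.
elim: N => [|N IH]; first by rewrite !big_ord0.
rewrite big_ord_recr /= IH [RHS]big_ord_recr /= subSnn big_ord1 big_ord_recr /= subnn addrA.
congr (_ + _); rewrite -big_split; apply: eq_bigr => i _ /=.
by rewrite subSn ?(ltnW (ltn_ord i)) // big_ord_recr.
Qed.

Lemma cbps_conv x N : \sum_(i < N) \sum_(j < N - i) ((cbin i)%:R * x ^+ i) * ((cbin j)%:R * x ^+ j)
  = \sum_(m < N) (4 * x) ^+ m.
Proof.
rewrite -(sum_antidiag (fun i j => ((cbin i)%:R * x ^+ i) * ((cbin j)%:R * x ^+ j))).
apply: eq_bigr => m _; rewrite exprMn -natrX -cbin_conv natr_sum mulr_suml.
apply: eq_bigr => i _; rewrite mulrACA -natrM -exprD subnKC //.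
by have := ltn_ord i.
Qed.

Lemma ord_widen_sum (F : nat -> R) m n : (m <= n)%N ->
  \sum_(i < n) F i = \sum_(i < m) F i + \sum_(i < n | (m <= i)%N) F i.
Proof.
move=> mn; rewrite [LHS](bigID (fun i : 'I_n => (i < m)%N)) /= (big_ord_widen _ F mn).
by congr (_ + _); apply: eq_bigl => i; rewrite -leqNgt.
Qed.

(** The part [i + j >= N] of the square of indices, which the triangle of [cbps_conv] misses. *)
Definition cbrem x N : R :=
  \sum_(i < N) \sum_(j < N | (N - i <= j)%N) ((cbin i)%:R * x ^+ i) * ((cbin j)%:R * x ^+ j).

Lemma cbps_sqr x N : cbps x N ^+ 2 = \sum_(m < N) (4 * x) ^+ m + cbrem x N.
Proof.
rewrite expr2 {1}/cbps mulr_suml -cbps_conv /cbrem -big_split; apply: eq_bigr => i _ /=.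
rewrite /cbps mulr_sumr.
by rewrite (ord_widen_sum (fun j => (cbin i)%:R * x ^+ i * ((cbin j)%:R * x ^+ j)) (leq_subr i N)).
Qed.

Lemma cbrem_norm x N : 0 <= x -> `|cbrem (- x) N| <= cbrem x N.
Proof.
move=> x0; apply: le_trans (ler_norm_sum _ _ _) _; apply: ler_sum => i _.
apply: le_trans (ler_norm_sum _ _ _) _; apply: ler_sum => j _.
by rewrite !normrM !normrX !normrN !normr_nat ger0_norm.
Qed.

(** The square of side [N] fits into the triangle [i + j < 2N]. Hence [cbrem] is at most a block of
    the geometric series and tends to 0. *)
Lemma cbps_sqr_le x N : 0 <= x -> cbps x N ^+ 2 <= \sum_(m < N.*2) (4 * x) ^+ m.
Proof.
move=> x0; pose t i j : R := ((cbin i)%:R * x ^+ i) * ((cbin j)%:R * x ^+ j).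
have t0 i j : 0 <= t i j by rewrite !mulr_ge0 ?exprn_ge0.
rewrite expr2 {1}/cbps mulr_suml -cbps_conv.
apply: (@le_trans _ _ (\sum_(i < N) \sum_(j < N.*2 - i) t i j)); last first.
  have NN : (N <= N.*2)%N by rewrite -addnn leq_addr.
  rewrite (ord_widen_sum (fun i => \sum_(j < N.*2 - i) t i j) NN).
  by rewrite lerDl; do 2!apply: sumr_ge0 => ? _.
apply: ler_sum => i _; rewrite /cbps mulr_sumr.
have Ni : (N <= N.*2 - i)%N by have := ltn_ord i; lia.
by rewrite (ord_widen_sum (t i) Ni) lerDl; apply: sumr_ge0.
Qed.

Lemma cvg_geom x : `|x| < 1 -> (fun N => \sum_(m < N) x ^+ m) @ \oo --> (1 - x)^-1.
Proof.
move=> x1; have := @cvg_geometric_series R 1 x x1; rewrite mul1r; apply: cvg_trans.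
apply: near_eq_cvg; near=> N; rewrite /series /= big_mkord.
by apply: eq_bigr => i _; rewrite /geometric /= mul1r.
Unshelve. all: by end_near. Qed.

Lemma cbrem_cvg0 x : 0 <= x -> 4 * x < 1 -> cbrem x @ \oo --> (0 : R).
Proof.
move=> x0 x1; have x4 : `|4 * x| < 1 by rewrite ger0_norm ?mulr_ge0.
have c1 := cvg_geom x4.
have dbl : (fun N : nat => N.*2) @ \oo --> \oo.
  apply/cvgnyPge => A; near=> N; rewrite -addnn; apply: leq_trans (leq_addr _ _).
  by near: N; exists A.
have c2 := cvg_comp _ _ dbl c1.
have c3 : (fun N => \sum_(m < N.*2) (4 * x) ^+ m - \sum_(m < N) (4 * x) ^+ m) @ \oo --> (0 : R).
  by rewrite -[X in _ --> X](subrr (1 - 4 * x)^-1); apply: cvgB; [exact: c2|exact: c1].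
apply: (@squeeze_cvgr nat \oo _ R (cst 0) _ (cbrem x) _ 0 (cvg_cst _) c3); near=> N.
apply/andP; split.
  by do 2!apply: sumr_ge0 => ? _; rewrite !mulr_ge0 ?exprn_ge0.
rewrite /= lerBrDr addrC -cbps_sqr; exact: cbps_sqr_le.
Unshelve. all: by end_near. Qed.

Lemma cbps_sqr_cvg x : 0 <= x -> 4 * x < 1 -> (fun N => cbps x N ^+ 2) @ \oo --> (1 - 4 * x)^-1.
Proof.
move=> x0 x1; have x4 : `|4 * x| < 1 by rewrite ger0_norm ?mulr_ge0.
rewrite -[_^-1]addr0; under eq_cvg => N do rewrite cbps_sqr.
exact: (cvgD (cvg_geom x4) (cbrem_cvg0 x0 x1)).
Qed.

Lemma cbpsN_sqr_cvg x : 0 <= x -> 4 * x < 1 -> (fun N => cbps (- x) N ^+ 2) @ \oo --> (1 + 4 * x)^-1.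
Proof.
move=> x0 x1; have x4 : `|4 * - x| < 1 by rewrite mulrN normrN ger0_norm ?mulr_ge0.
have r0 : cbrem (- x) @ \oo --> (0 : R).
  apply: norm_cvg0; apply: (@squeeze_cvgr nat \oo _ R (cst 0) _ _ _ 0 (cvg_cst _) (cbrem_cvg0 x0 x1)).
  by near=> N; rewrite normr_ge0 cbrem_norm.
rewrite -[_^-1]addr0 -[X in 1 + X]opprK -mulrN; under eq_cvg => N do rewrite cbps_sqr.
exact: (cvgD (cvg_geom x4) r0).
Unshelve. all: by end_near. Qed.

Definition ecbps x N : R := \sum_(k < N) (cbin k.*2)%:R * x ^+ k.*2.
Definition ocbps x N : R := \sum_(k < N) (cbin k.*2.+1)%:R * x ^+ k.*2.+1.

Lemma cbps_double x N : cbps x N.*2 = ecbps x N + ocbps x N.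
Proof.
rewrite /cbps /ecbps /ocbps; elim: N => [|N IH]; first by rewrite !big_ord0 addr0.
by rewrite doubleS !big_ord_recr /= IH; ring.
Qed.

Lemma cbpsN_double x N : cbps (- x) N.*2 = ecbps x N - ocbps x N.
Proof.
rewrite cbps_double -[in RHS]sumrN; congr (_ + _); apply: eq_bigr => k _.
  by rewrite -mul2n [in RHS]exprM [in LHS]exprM sqrrN.
by rewrite !exprS -mul2n [in RHS]exprM [in LHS]exprM sqrrN mulNr mulrN.
Qed.

(** The limits of the squares leave a sign open; this bound makes the even-length partial sums at
    [- x] nonnegative. *)
Lemma ocbps_le x N : 0 <= x -> 4 * x < 1 -> ocbps x N <= ecbps x N.
Proof.
move=> x0 x1; apply: ler_sum => k _; rewrite exprS mulrA.
apply: ler_wpM2r; first exact: exprn_ge0.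
apply: le_trans (_ : (4 * cbin k.*2)%:R * x <= _).
  by rewrite ler_wpM2r // ler_nat cbin_le4.
by rewrite natrM mulrAC -[leRHS]mul1r ler_wpM2r // ltW.
Qed.

Lemma ecbps_cvg x : 0 <= x -> 4 * x < 1 ->
  ecbps x @ \oo --> (Num.sqrt (1 - 4 * x)^-1 + Num.sqrt (1 + 4 * x)^-1) / 2.
Proof.
move=> x0 x1.
have dbl : (fun N : nat => N.*2) @ \oo --> \oo.
  apply/cvgnyPge => A; near=> N; rewrite -addnn; apply: leq_trans (leq_addr _ _).
  by near: N; exists A.
have o0 N : 0 <= ocbps x N by apply: sumr_ge0 => k _; rewrite mulr_ge0 ?exprn_ge0.
have p0 N : 0 <= cbps x N.*2 by rewrite cbps_double addr_ge0 // (le_trans (o0 N)) ?ocbps_le.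
have n0 N : 0 <= cbps (- x) N.*2 by rewrite cbpsN_double subr_ge0 ocbps_le.
have c1 : (fun N => cbps x N.*2) @ \oo --> Num.sqrt (1 - 4 * x)^-1.
  have := cvg_comp _ _ (cvg_comp _ _ dbl (cbps_sqr_cvg x0 x1)) (@sqrt_continuous R _).
  by apply: cvg_trans; apply: near_eq_cvg; near=> N; rewrite /= sqrtr_sqr ger0_norm.
have c2 : (fun N => cbps (- x) N.*2) @ \oo --> Num.sqrt (1 + 4 * x)^-1.
  have := cvg_comp _ _ (cvg_comp _ _ dbl (cbpsN_sqr_cvg x0 x1)) (@sqrt_continuous R _).
  by apply: cvg_trans; apply: near_eq_cvg; near=> N; rewrite /= sqrtr_sqr ger0_norm.
have E N : ecbps x N = (cbps x N.*2 + cbps (- x) N.*2) * 2^-1.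
  by rewrite cbpsN_double cbps_double; field.
under eq_cvg => N do rewrite E.
exact: (cvgM (cvgD c1 c2) (cvg_cst _)).
Unshelve. all: by end_near. Qed.

End CentralBinomialSeries.

(** * Growth rate *)

Definition bridges d := 'C(d.*2.*2.-1, d.*2).

Lemma bridgesE d : (0 < d)%N -> (2 * bridges d = cbin d.*2)%N.
Proof.
rewrite /bridges /cbin; case: d => // d _.
rewrite [d.+1.*2]doubleS; move: d.*2.+1 => e.
rewrite doubleS succnK [in RHS]binS mul2n -addnn; congr (_ + _)%N.
by rewrite -bin_sub; [congr 'C(_, _)|]; lia.
Qed.

Lemma cbin_le_exp k : (cbin k <= 4 ^ k)%N.
Proof.
elim: k => // k IH; apply: leq_trans (cbin_le4 k) _.
by rewrite expnS leq_mul2l IH orbT.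
Qed.

Lemma nmark_bridges k :
  nmark k = (cbin k.*2.+1 + \sum_(d < k) bridges d.+1 * nmark (k - d.+1))%N.
Proof.
rewrite nmark_renewal; congr (_ + _)%N.
rewrite (reindex_inj rev_ord_inj) /=; apply: eq_bigr => i _.
by rewrite /bridges; have := ltn_ord i => ik; congr ('C(_, _) * _)%N; lia.
Qed.

Lemma nmark_gt0 k : (0 < nmark k)%N.
Proof. by rewrite nmark_bridges ltn_addr // bin_gt0; lia. Qed.

Section Renewal.
Variable R : realType.
Local Notation alpha := (alpha R).

Lemma sqrt73 : 8 < Num.sqrt (73 : R) < 9.
Proof.
have s0 : 0 <= Num.sqrt 73 :> R by exact: sqrtr_ge0.
have s2 : Num.sqrt 73 ^+ 2 = 73 :> R by rewrite sqr_sqrtr //; lra.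
by apply/andP; split; rewrite ltNge; apply/negP => h; nra.
Qed.

Lemma alpha_bounds : 17 < alpha < 18.
Proof. by rewrite /alpha; have := sqrt73; lra. Qed.

Lemma alpha_gt0 : 0 < alpha.
Proof. by have := alpha_bounds; lra. Qed.

Definition renewal_mass (b : R) N : R := \sum_(d < N) (bridges d.+1)%:R * b^-1 ^+ d.+1.

Lemma renewal_massE N :
  renewal_mass alpha N = (ecbps (Num.sqrt alpha^-1) N.+1 - 1) / 2.
Proof.
rewrite /ecbps big_ord_recl /= expr0 mulr1 {1}/cbin bin0 addrAC subrr add0r mulr_suml.
apply: eq_bigr => d _; rewrite /bump /= add1n -bridgesE // natrM -mul2n exprM sqr_sqrtr.
  by field.
by rewrite invr_ge0 ltW // alpha_gt0.
Qed.

Lemma renewal_mass_cvg : renewal_mass alpha @ \oo --> (1 : R).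
Proof.
have /andP[al au] := alpha_bounds; have a0 := alpha_gt0.
have /andP[sl su] := sqrt73.
have s2 : Num.sqrt 73 ^+ 2 = 73 :> R by rewrite sqr_sqrtr //; lra.
set x := Num.sqrt alpha^-1.
have x0 : 0 <= x by exact: sqrtr_ge0.
have x2 : x ^+ 2 = alpha^-1 by rewrite sqr_sqrtr // invr_ge0 ltW.
have ai : alpha^-1 < 17^-1 by rewrite ltf_pV2 ?posrE //; lra.
have x1 : 4 * x < 1 by rewrite ltNge; apply/negP => h; nra.
have := ecbps_cvg x0 x1.
(* Origin of the 73: with s1 and s3 the two square roots below and q = s1 s3, one has s1^2 + s3^2 =
   2 q^2. So s1 + s3 = 6 means q^2 + q = 18, and alpha = 16 q^2 / (q^2 - 1). *)
set q := (Num.sqrt 73 - 1) / 2 : R.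
have q0 : 0 <= q by rewrite /q; lra.
have qE : (1 - (4 * x) ^+ 2)^-1 = q ^+ 2.
  have e1 : 1 - (4 * x) ^+ 2 = 1 - 16 * alpha^-1 by rewrite exprMn x2; ring.
  have d0 : 611 + Num.sqrt 73 != 0 :> R by apply: lt0r_neq0; lra.
  have d1 : 35 + Num.sqrt 73 != 0 :> R by apply: lt0r_neq0; lra.
  have -> : 1 - (4 * x) ^+ 2 = (35 + Num.sqrt 73) / (611 + Num.sqrt 73).
    by rewrite e1 /alpha invf_div; field.
  rewrite invf_div; apply: (mulIf d1); rewrite divfK //.
  have -> : q ^+ 2 * (35 + Num.sqrt 73) = (Num.sqrt 73 ^+ 2 * Num.sqrt 73 + 33 * Num.sqrt 73 ^+ 2 - 69 * Num.sqrt 73 + 35) / 4.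
    by rewrite /q; field.
  by rewrite s2; field.
have -> : (Num.sqrt (1 - 4 * x)^-1 + Num.sqrt (1 + 4 * x)^-1) / 2 = 3.
  set s1 := Num.sqrt (1 - 4 * x)^-1; set s3 := Num.sqrt (1 + 4 * x)^-1.
  have p1 : 0 < 1 - 4 * x by lra.
  have p2 : 0 < 1 + 4 * x by lra.
  have s10 : 0 <= s1 by exact: sqrtr_ge0.
  have s30 : 0 <= s3 by exact: sqrtr_ge0.
  have sum : s1 ^+ 2 + s3 ^+ 2 = 2 * q ^+ 2.
    rewrite !sqr_sqrtr ?invr_ge0 ?ltW // -qE.
    have : 1 - (4 * x) ^+ 2 != 0 by apply: lt0r_neq0; nra.
    have := lt0r_neq0 p1; have := lt0r_neq0 p2 => h1 h2 h3.
    by field; rewrite h1 h2 h3.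
  have prod : s1 * s3 = q.
    rewrite -sqrtrM ?invr_ge0 ?ltW // -invfM -[RHS]ger0_norm // -sqrtr_sqr -qE.
    by congr (Num.sqrt _^-1); ring.
  have s6 : (s1 + s3) ^+ 2 = 6 ^+ 2.
    have -> : (s1 + s3) ^+ 2 = s1 ^+ 2 + s3 ^+ 2 + 2 * (s1 * s3) by ring.
    rewrite sum prod.
    have -> : 2 * q ^+ 2 + 2 * q = (Num.sqrt 73 ^+ 2 - 1) / 2 by rewrite /q; field.
    by rewrite s2; field.
  suff -> : s1 + s3 = 6 by field.
  apply/eqP; rewrite -(@eqrXn2 _ 2 _ _ isT (addr_ge0 s10 s30)) //; exact/eqP.
move=> c; have c' : (fun N => ecbps x N.+1) @ \oo --> (3 : R).
  by move: c; rewrite -(cvg_shiftS (ecbps x)).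
have -> : renewal_mass alpha = (fun N => (ecbps x N.+1 - 1) * 2^-1).
  by apply: funext => N; rewrite renewal_massE.
rewrite -[X in _ --> X](_ : (3 - 1) * 2^-1 = 1); last by field.
by apply: cvgM; [apply: cvgB; [exact: c'|exact: cvg_cst]|exact: cvg_cst].
Qed.

Lemma renewal_mass_le1 N : renewal_mass alpha N <= 1.
Proof.
have nd : nondecreasing_seq (renewal_mass alpha).
  apply/nondecreasing_seqP => k; rewrite /renewal_mass big_ord_recr /= lerDl.
  by rewrite mulr_ge0 // exprn_ge0 // invr_ge0 ltW // alpha_gt0.
have c := renewal_mass_cvg.
have := nondecreasing_cvgn_le nd (cvgP _ c) N.
by rewrite (cvg_lim _ c).
Qed.

Lemma renewal_mass_ge r : r < 1 -> exists N, r <= renewal_mass alpha N.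
Proof.
move=> r1; have := renewal_mass_cvg => /cvgrPdist_lt /(_ (1 - r)).
rewrite subr_gt0 => /(_ r1) [N _ /(_ N (leqnn N))] /= h; exists N.
by move: h; rewrite ger0_norm ?subr_ge0 ?renewal_mass_le1 //; lra.
Qed.

(** As the mass at [alpha] is at most 1, the renewal sum takes at most the share [alpha / b] of C
    b^k. The flip-free term is at most 4 * 16^k, hence at most 4 b^k, and [C] solves 4 + C alpha / b
    = C. *)
Lemma nmark_ub (b : R) : alpha < b -> exists2 C, 0 < C & forall k, (nmark k)%:R <= C * b ^+ k.
Proof.
move=> ab; have a0 := alpha_gt0; have b0 := lt_trans a0 ab.
have /andP[al au] := alpha_bounds.
pose C := 4 * b / (b - alpha).
have ba : 0 < b - alpha by rewrite subr_gt0.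
have C0 : 0 < C by rewrite divr_gt0 // mulr_gt0.
exists C => // k; elim/ltn_ind: k => k IH.
rewrite nmark_bridges natrD natr_sum.
have h1 : (cbin k.*2.+1)%:R <= 4 * b ^+ k.
  apply: le_trans (_ : (4 ^ k.*2.+1)%:R <= _); first by rewrite ler_nat cbin_le_exp.
  rewrite natrX exprS ler_pM2l // -mul2n exprM lerXn2r ?nnegrE //; lra.
have h2 : \sum_(d < k) (bridges d.+1 * nmark (k - d.+1))%:R <= C * b ^+ k * (alpha / b).
  apply: le_trans (_ : \sum_(d < k) (C * b ^+ k * (alpha / b)) * ((bridges d.+1)%:R * alpha^-1 ^+ d.+1) <= _).
    apply: ler_sum => d _; have dk := ltn_ord d; rewrite natrM.
    have := IH (k - d.+1)%N; rewrite ltn_subLR // => /(_ (leq_addl _ _)) h.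
    have -> : C * b ^+ k * (alpha / b) * ((bridges d.+1)%:R * alpha^-1 ^+ d.+1) =
       (bridges d.+1)%:R * (C * (b ^+ k * (b^-1 * alpha^-1 ^+ d))).
      by rewrite exprS; field; rewrite !lt0r_neq0.
    rewrite ler_wpM2l //; apply: le_trans h _; rewrite ler_pM2l //.
    have -> : b ^+ k = b ^+ (k - d.+1) * b ^+ d.+1 by rewrite -exprD subnK.
    rewrite -mulrA; apply: ler_peMr; first by rewrite exprn_ge0 ?ltW.
    rewrite exprS mulrACA divff ?lt0r_neq0 // mul1r -exprMn exprn_ege1 //.
    by rewrite ler_pdivlMr // mul1r ltW.
  rewrite -mulr_sumr -[leRHS]mulr1; apply: ler_wpM2l; last exact: renewal_mass_le1.
  exact: ltW (mulr_gt0 (mulr_gt0 C0 (exprn_gt0 k b0)) (divr_gt0 a0 b0)).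
apply: le_trans (lerD h1 h2) _.
rewrite le_eqVlt; apply/orP; left; apply/eqP.
by rewrite /C; field; rewrite !lt0r_neq0.
Qed.

(** Finitely many bridges already have mass [b / alpha], and passing from [alpha] to [b] gains at
    least the factor [alpha / b] on each. The constant [b ^- N] covers the initial values
    [k < N]. *)
Lemma nmark_lb (b : R) : 1 <= b -> b < alpha -> exists2 C, 0 < C & forall k, C * b ^+ k <= (nmark k)%:R.
Proof.
move=> b1 ba; have a0 := alpha_gt0; have b0 : 0 < b by lra.
have [N hN] : exists N, b / alpha <= renewal_mass alpha N.
  by apply: renewal_mass_ge; rewrite ltr_pdivrMr // mul1r.
exists (b ^- N); first by rewrite invr_gt0 exprn_gt0.
move=> k; elim/ltn_ind: k => k IH; case: (ltnP k N) => [kN|Nk].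
  apply: le_trans (_ : 1 <= _); last by rewrite ler1n nmark_gt0.
  by rewrite mulrC ler_pdivrMr ?exprn_gt0 // mul1r ler_weXn2l // ltnW.
rewrite nmark_bridges natrD natr_sum; apply: ler_wpDl => //.
rewrite (ord_widen_sum (fun d => (bridges d.+1 * nmark (k - d.+1))%:R) Nk).
apply: ler_wpDr; first by apply: sumr_ge0.
apply: le_trans (_ : \sum_(d < N) (b ^- N * b ^+ k * (alpha / b)) * ((bridges d.+1)%:R * alpha^-1 ^+ d.+1) <= _).
  rewrite -mulr_sumr; apply: le_trans (_ : b ^- N * b ^+ k * (alpha / b) * (b / alpha) <= _).
    rewrite le_eqVlt; apply/orP; left; apply/eqP; field.
    by rewrite !lt0r_neq0 // exprn_gt0.
  apply: ler_wpM2l hN; apply: ltW (mulr_gt0 (mulr_gt0 _ (exprn_gt0 k b0)) (divr_gt0 a0 b0)).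
  by rewrite invr_gt0 exprn_gt0.
apply: ler_sum => d _; have dk : (d < k)%N := leq_trans (ltn_ord d) Nk; rewrite natrM.
have := IH (k - d.+1)%N; rewrite ltn_subLR // => /(_ (leq_addl _ _)) h.
have -> : b ^- N * b ^+ k * (alpha / b) * ((bridges d.+1)%:R * alpha^-1 ^+ d.+1) =
     (bridges d.+1)%:R * (b ^- N * (b ^+ k * (b^-1 * alpha^-1 ^+ d))).
  by rewrite exprS; field; rewrite !lt0r_neq0 // exprn_gt0.
rewrite ler_wpM2l //; apply: le_trans h; rewrite ler_wpM2l ?invr_ge0 ?exprn_ge0 ?(ltW b0) //.
have -> : b ^+ k = b ^+ (k - d.+1) * b ^+ d.+1 by rewrite -exprD subnK.
rewrite -mulrA ger_pMr ?exprn_gt0 //.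
rewrite exprS mulrACA divff ?lt0r_neq0 // mul1r -exprMn exprn_ile1 //.
  by rewrite divr_ge0 // ltW.
by rewrite ler_pdivrMr // mul1r ltW.
Qed.

End Renewal.

Section Growth.
Variable R : realType.
Local Notation alpha := (alpha R).
Local Notation F n := (nconf n n n).

Lemma le0_of_mulrn_bounded (a b : R) : (forall k : nat, k%:R * a <= b) -> a <= 0.
Proof.
move=> h; rewrite leNgt; apply/negP => a0.
have b0 : 0 <= b by have := h 0%N; rewrite mul0r.
have := archi_boundP (divr_ge0 b0 (ltW a0)); rewrite ltr_pdivrMr // => hk.
by have := lt_le_trans hk (h _); rewrite ltxx.
Qed.

Lemma nconf_diag_gt0R n : 0 < (F n)%:R :> R.
Proof. by rewrite ltr0n nconf_diag_gt0. Qed.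

(** Dividing the logarithm of the bound on the k-th power by [k] removes the constant of [nmark_ub];
    then [e] tends to 0. *)
Lemma ln_nconf_ub n : ln ((F n)%:R : R) <= n%:R * ln alpha.
Proof.
have a0 := alpha_gt0 R.
suff H e : 0 < e -> ln ((F n)%:R : R) <= n%:R * (ln alpha + e).
  apply/ler_addgt0Pr => e e0.
  have n1 : 0 < n.+1%:R :> R by rewrite ltr0n.
  apply: le_trans (H _ (divr_gt0 e0 n1)) _; rewrite mulrDr lerD2l mulrCA ger_pMr //.
  by rewrite ler_pdivrMr // mul1r ler_nat.
move=> e0; have e1 : 1 < expR e by rewrite expR_gt1.
have ab : alpha < alpha * expR e by rewrite ltr_pMr.
have [C C0 hC] := nmark_ub ab.
have b0 : 0 < alpha * expR e by rewrite mulr_gt0 // expR_gt0.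
rewrite -subr_le0; apply: (@le0_of_mulrn_bounded _ (ln C)) => k.
have : (F n)%:R ^+ k <= C * (alpha * expR e) ^+ (k * n) :> R.
  apply: le_trans (hC _); rewrite -natrX ler_nat.
  exact: leq_trans (nconf_diag_exp _ _) (nconf_diag_le_nmark _).
rewrite -ler_ln ?posrE ?exprn_gt0 ?nconf_diag_gt0R ?mulr_gt0 ?exprn_gt0 //.
rewrite lnM ?posrE ?exprn_gt0 // !lnXn ?nconf_diag_gt0R // lnM ?posrE ?expR_gt0 // expRK.
rewrite -[_ *+ k]mulr_natl -[_ *+ (k * n)]mulr_natl natrM => h.
by rewrite mulrBr lerBlDr mulrA.
Qed.

Lemma nconf_diag_monoS n : (F n <= F n.+1)%N.
Proof.
have := nconf_diag_supermul 1 n; rewrite add1n; apply: leq_trans.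
by rewrite leq_pmull // nconf_diag_gt0.
Qed.

(** Crude, but it keeps [ln alpha - 3 * d] nonnegative for [d <= 1 / 8]. *)
Lemma ln_alpha_lb : 15 / 16 < ln alpha.
Proof.
have /andP[al au] := alpha_bounds R; have a0 := alpha_gt0 R.
have ai : alpha^-1 < 17^-1 by rewrite ltf_pV2 ?posrE //; lra.
have ai0 : 0 < alpha^-1 by rewrite invr_gt0.
have : ln (1 + (alpha^-1 - 1)) <= alpha^-1 - 1 by apply: le_ln1Dx; lra.
have -> : 1 + (alpha^-1 - 1) = alpha^-1 by ring.
rewrite lnV ?posrE //; lra.
Qed.

(** The tangent of [ln] at 1/d; its small slope absorbs the polynomial factor. *)
Lemma ln_le_affine (d y : R) : 0 < d -> 0 < y -> ln y <= d * y - ln d - 1.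
Proof.
move=> d0 y0; have dy := mulr_gt0 d0 y0.
have : ln (1 + (d * y - 1)) <= d * y - 1 by apply: le_ln1Dx; lra.
have -> : 1 + (d * y - 1) = d * y by ring.
by rewrite lnM ?posrE //; lra.
Qed.

(** Of the loss [3 * d], one part comes from b = alpha exp(-d) and two from the squared polynomial
    factor of [nconf_diag_ge]. *)
Lemma ln_nconf_even_lb (d : R) : 0 < d -> d <= 1 / 8 ->
  exists K, forall m, (2 * m)%N%:R * (ln alpha - 3 * d) - K <= ln ((F (2 * m)%N)%:R : R).
Proof.
move=> d0 d1; have a0 := alpha_gt0 R; have /andP[al au] := alpha_bounds R.
have e1 : expR (- d) < 1 by rewrite expR_lt1; lra.
have e2 : 1 / 2 <= expR (- d) by apply: le_trans (expR_ge1Dx _); lra.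
have ba : alpha * expR (- d) < alpha by rewrite gtr_pMr.
have b1 : 1 <= alpha * expR (- d) by nra.
have b0 : 0 < alpha * expR (- d) by lra.
have [C C0 hC] := nmark_lb b1 ba.
pose K0 := 2 * ln C - 2 * (ln alpha - d) - 2 * d + 2 * ln d + 2.
exists (`|K0|) => -[|m].
  rewrite muln0 mul0r sub0r; apply: le_trans (_ : 0 <= _); first by rewrite oppr_le0.
  by rewrite ln_ge0 // ler1n nconf_diag_gt0.
have h1 : (C * (alpha * expR (- d)) ^+ m) ^+ 2 <= ((2 * m.+1)%N.+1%:R) ^+ 2 * (F (2 * m.+1)%N)%:R :> R.
  apply: le_trans (_ : ((nmark m)%:R) ^+ 2 <= _).
    by rewrite lerXn2r ?nnegrE // mulr_ge0 ?exprn_ge0 // ltW.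
  rewrite -!natrX -natrM ler_nat mul2n; apply: leq_trans (nconf_diag_ge m.+1).
  by rewrite leq_exp2r // nmark_le_nconf_tot.
have p0 : 0 < C * (alpha * expR (- d)) ^+ m by rewrite mulr_gt0 ?exprn_gt0.
have q0 : 0 < (2 * m.+1)%N.+1%:R :> R by rewrite ltr0n.
move: h1; rewrite -ler_ln ?posrE ?mulr_gt0 ?exprn_gt0 ?nconf_diag_gt0R // [ln (_ * (F _)%:R)]lnM ?posrE ?exprn_gt0 ?nconf_diag_gt0R //.
have lnb : ln (alpha * expR (- d)) = ln alpha - d by rewrite lnM ?posrE ?expR_gt0 // expRK.
have -> : ln ((C * (alpha * expR (- d)) ^+ m) ^+ 2) = 2 * (ln C + m%:R * (ln alpha - d)).
  rewrite lnXn // lnM ?posrE ?exprn_gt0 // (lnXn m b0) lnb -[_ *+ m]mulr_natl; ring.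
have -> : ln ((2 * m.+1)%N.+1%:R ^+ 2) = 2 * ln (2 * m.+1)%N.+1%:R :> R by rewrite (lnXn 2 q0); ring.
have h2 := ln_le_affine d0 q0.
have h3 : K0 <= `|K0| by exact: ler_norm.
have h4 : - K0 <= `|K0| by rewrite -normrN ler_norm.
set LF := ln (F _)%:R; set LQ := ln _.+1%:R in h2 *.
move: h2.
have -> : (2 * m.+1)%N.+1%:R = 2 * m%:R + 3 :> R by rewrite -natr1 natrM -[m.+1%:R]natr1; ring.
have -> : (2 * m.+1)%N%:R = 2 * m%:R + 2 :> R by rewrite natrM -[m.+1%:R]natr1; ring.
move=> h2 h1; rewrite /K0 in h3 h4; lra.
Qed.

Lemma ln_nconf_lb (e : R) : 0 < e ->
  exists K, forall n, n%:R * (ln alpha - e) - K <= ln ((F n)%:R : R).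
Proof.
move=> e0; have La := ln_alpha_lb.
pose d := Num.min (e / 3) (1 / 8).
have d0 : 0 < d by rewrite lt_min; apply/andP; split; lra.
have d1 : d <= 1 / 8 by rewrite ge_min lexx orbT.
have d2 : d <= e / 3 by rewrite ge_min lexx.
have [K hK] := ln_nconf_even_lb d0 d1.
exists (K + ln alpha) => n; have := hK n./2.
have le1 : ln ((F (2 * n./2)%N)%:R : R) <= ln ((F n)%:R : R).
  rewrite ler_ln ?posrE ?nconf_diag_gt0R // ler_nat mul2n.
  move: (n./2) (odd_double_half n) => m; case: (odd n) => /= <- //.
  exact: nconf_diag_monoS.
have nE : n%:R <= (2 * n./2)%N%:R + 1 :> R.
  by rewrite natr1 ler_nat -{1}(odd_double_half n) mul2n; case: (odd n); rewrite ?add1n.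
have n0 : 0 <= n%:R :> R by [].
set q := (2 * n./2)%N%:R in nE *; move=> h.
apply: le_trans le1; apply: le_trans h.
have : n%:R * (ln alpha - e) <= n%:R * (ln alpha - 3 * d) by rewrite ler_wpM2l //; lra.
have : n%:R * (ln alpha - 3 * d) <= (q + 1) * (ln alpha - 3 * d) by rewrite ler_wpM2r //; lra.
lra.
Qed.

Lemma ln_nconf_cvg : (fun n => ln ((F n)%:R : R) / n%:R) @ \oo --> ln alpha.
Proof.
apply/cvgrPdist_le => e e0.
have e2 : 0 < e / 2 by lra.
have [K hK] := ln_nconf_lb e2.
near=> n.
have n0 : 0 < n%:R :> R by rewrite ltr0n; near: n; exists 1%N.
have Kn : K / n%:R <= e / 2.
  rewrite ler_pdivrMr // mulrC -ler_pdivrMr //.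
  near: n; apply: nbhs_infty_ger.
have ub : ln ((F n)%:R : R) / n%:R <= ln alpha by rewrite ler_pdivrMr // mulrC ln_nconf_ub.
rewrite ger0_norm ?subr_ge0 // lerBlDr -lerBlDl.
rewrite ler_pdivlMr //; apply: le_trans (hK n).
move: Kn; rewrite ler_pdivrMr // => Kn; lra.
Unshelve. all: by end_near. Qed.

End Growth.

(** * Logarithm bounds *)

Section LogBounds.
Variable R : realType.
Implicit Types z : R.

Lemma le_of_derive (g dg : R -> R) z : 0 <= z ->
  (forall x, 0 <= x <= z -> is_derive x 1 g (dg x)) ->
  (forall x, 0 <= x <= z -> 0 <= dg x) -> g 0 <= g z.
Proof.
move=> z0 dgx dg0.
apply: (@ger0_derive1_ndecr R g 0 z) => //.
- by move=> x; rewrite in_itv /= => /andP[/ltW x0 /ltW xz]; have [] := dgx x; rewrite ?x0 ?xz.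
- move=> x; rewrite in_itv /= => /andP[/ltW x0 /ltW xz].
  have xI : 0 <= x <= z by rewrite x0 xz.
  by rewrite derive1E; have := dgx x xI => d; rewrite derive_val dg0.
- apply: derivable_within_continuous => x; rewrite in_itv /= => xI.
  by have [] := dgx x xI.
Qed.

(* Partial sums of ln ((1 + z) / (1 - z)) = 2 artanh z. *)
Definition artanh2 N z : R := \sum_(k < N) (2 / k.*2.+1%:R) * z ^+ k.*2.+1.

Lemma is_derive_monomial (a : R) n z :
  is_derive z 1 (fun x : R => a * x ^+ n.+1) (a * n.+1%:R * z ^+ n).
Proof.
have := is_derive_poly (a *: 'X^(n.+1)) z.
have -> : horner (a *: 'X^(n.+1)) = (fun x : R => a * x ^+ n.+1).
  by apply: funext => x; rewrite hornerZ hornerXn.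
by rewrite derivZ derivXn hornerZ hornerMn hornerXn -[_ *+ _]mulr_natl mulrA.
Qed.

Lemma is_derive_artanh2 N z :
  is_derive z 1 (artanh2 N) (2 * \sum_(k < N) (z ^+ 2) ^+ k).
Proof.
elim: N => [|N IH].
  have -> : artanh2 0 = cst 0 by apply: funext => x; rewrite /artanh2 big_ord0.
  by rewrite big_ord0 mulr0; exact: is_derive_cst.
have -> : artanh2 N.+1 = artanh2 N + (fun x => 2 / N.*2.+1%:R * x ^+ N.*2.+1).
  by apply: funext => x; rewrite /artanh2 big_ord_recr.
have h := is_deriveD IH (is_derive_monomial (2 / N.*2.+1%:R) N.*2 z).
rewrite big_ord_recr /= mulrDr -exprM mul2n.
by rewrite divfK ?pnatr_eq0 in h.
Qed.

Lemma geom_sum N (t : R) : (1 - t) * (\sum_(k < N) t ^+ k) = 1 - t ^+ N.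
Proof. by rewrite -opprB mulNr -subrX1 opprB. Qed.

Let g N (z : R) : R := ln (1 + z) - ln (1 - z) - artanh2 N z.

(** The logarithms have derivative 2 / (1 - z^2); subtracting the truncated geometric series leaves
    its tail. *)
Let is_derive_g N z : 0 <= z < 1 -> is_derive z 1 (g N) (2 * z ^+ 2 ^+ N / (1 - z ^+ 2)).
Proof.
move=> /andP[z0 z1].
have p1 : 0 < 1 + z by lra.
have p2 : 0 < 1 - z by lra.
have d1 : is_derive z 1 (fun x : R => ln (1 + x)) (1 + z)^-1.
  have i : is_derive z 1 (fun x : R => 1 + x) 1.
    have := is_derive_poly (1 + 'X) z.
    have -> : horner (1 + 'X) = (fun x : R => 1 + x) by apply: funext => x; rewrite !hornerE.
    by rewrite derivD derivX derivC add0r hornerC.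
  by have := @is_derive1_comp R (@ln R) (fun x => 1 + x) z _ _ (is_derive1_ln p1) i; rewrite mulr1.
have d2 : is_derive z 1 (fun x : R => ln (1 - x)) (- (1 - z)^-1).
  have i : is_derive z 1 (fun x : R => 1 - x) (-1).
    have := is_derive_poly (1 - 'X) z.
    have -> : horner (1 - 'X) = (fun x : R => 1 - x) by apply: funext => x; rewrite !hornerE.
    by rewrite derivB derivX derivC sub0r hornerN hornerC.
  by have := @is_derive1_comp R (@ln R) (fun x => 1 - x) z _ _ (is_derive1_ln p2) i; rewrite mulrN1.
have h := is_deriveB (is_deriveB d1 d2) (is_derive_artanh2 N z).
have -> : 2 * z ^+ 2 ^+ N / (1 - z ^+ 2) = (1 + z)^-1 - - (1 - z)^-1 - 2 * \sum_(k < N) z ^+ 2 ^+ k; last exact: h.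
rewrite opprK.
have e : 1 - z ^+ 2 = (1 - z) * (1 + z) by ring.
have ne : 1 - z ^+ 2 != 0 by rewrite e mulf_neq0 // lt0r_neq0.
have gs := geom_sum N (z ^+ 2).
have -> : \sum_(k < N) z ^+ 2 ^+ k = (1 - z ^+ 2 ^+ N) / (1 - z ^+ 2).
  by rewrite -gs mulrC mulKf.
by rewrite e; field; rewrite !lt0r_neq0.
Qed.

Let g0 N : g N 0 = 0.
Proof.
rewrite /g subr0 addr0 ln1 subr0 sub0r /artanh2 big1 ?oppr0 // => k _.
by rewrite expr0n mulr0.
Qed.

Lemma ln_artanh_lb N z : 0 <= z < 1 -> artanh2 N z <= ln (1 + z) - ln (1 - z).
Proof.
move=> /andP[z0 z1]; rewrite -subr_ge0 -(g0 N).
pose dg (x : R) := 2 * x ^+ 2 ^+ N / (1 - x ^+ 2).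
apply: (@le_of_derive (g N) dg z z0) => x /andP[x0 xz].
  by apply: is_derive_g; rewrite x0 (le_lt_trans xz).
have xl : x < 1 by exact: le_lt_trans z1.
rewrite /dg divr_ge0 ?mulr_ge0 ?exprn_ge0 //; nra.
Qed.

(** On this range 1 - x^2 is at least 1/2, so the tail is at most 4 x^(2N), whose integral is the
    error term. *)
Lemma ln_artanh_ub N z : 0 <= z <= 1 / 2 ->
  ln (1 + z) - ln (1 - z) <= artanh2 N z + 4 / N.*2.+1%:R * z ^+ N.*2.+1.
Proof.
move=> /andP[z0 z1].
pose h (x : R) := 4 / N.*2.+1%:R * x ^+ N.*2.+1 - g N x.
have h0 : h 0 = 0 by rewrite /h g0 expr0n /= mulr0 subr0.
suff : h 0 <= h z by rewrite h0 /h subr_ge0 /g => hz; rewrite -lerBlDl.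
pose dh (x : R) := 4 * x ^+ 2 ^+ N - 2 * x ^+ 2 ^+ N / (1 - x ^+ 2).
apply: (@le_of_derive h dh z z0) => x /andP[x0 xz].
  have xI : 0 <= x < 1 by lra.
  have dx : is_derive x 1 (fun x : R => 4 / N.*2.+1%:R * x ^+ N.*2.+1) (4 * x ^+ 2 ^+ N).
    by have := is_derive_monomial (4 / N.*2.+1%:R) N.*2 x; rewrite -exprM mul2n divfK ?pnatr_eq0.
  by have := is_deriveB dx (is_derive_g N xI); exact.
have px : 1 / 2 <= 1 - x ^+ 2 by nra.
have px0 : 0 < 1 - x ^+ 2 by lra.
have t0 : 0 <= x ^+ 2 ^+ N by rewrite !exprn_ge0.
rewrite /dh subr_ge0 ler_pdivrMr //; nra.
Qed.

Lemma ln_artanh_between N l z u : 0 <= l -> l <= z -> z <= u -> u <= 1 / 2 ->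
  artanh2 N l <= ln (1 + z) - ln (1 - z) <=
    artanh2 N u + 4 / N.*2.+1%:R * u ^+ N.*2.+1.
Proof.
move=> l0 lz zu u1.
have mono (x y : R) : 0 <= x -> x <= y -> y <= 1 / 2 ->
    ln (1 + x) - ln (1 - x) <= ln (1 + y) - ln (1 - y).
  by move=> x0 xy y1; apply: lerB; rewrite ler_ln ?posrE; lra.
have il : 0 <= l < 1 by lra.
have iu : 0 <= u <= 1 / 2 by lra.
apply/andP; split.
  by apply: le_trans (ln_artanh_lb N il) _; apply: mono; lra.
by apply: le_trans (ln_artanh_ub N iu); apply: mono; lra.
Qed.

Lemma ln2_bounds : 693 / 10 ^+ 3 + 147 / 10 ^+ 6 + 180 / 10 ^+ 9 < ln (2 : R) <
    693 / 10 ^+ 3 + 147 / 10 ^+ 6 + 182 / 10 ^+ 9.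
Proof.
have z0 : 0 <= 1 / 3 :> R by lra.
have z1 : 1 / 3 <= 1 / 2 :> R by lra.
have e : ln (2 : R) = ln (1 + 1 / 3) - ln (1 - 1 / 3).
  by rewrite -ln_div ?posrE; [congr ln; field|lra|lra].
have := ln_artanh_between 9 z0 (lexx _) (lexx _) z1; rewrite -e.
rewrite /artanh2 !big_ord_recr big_ord0 /= !doubleS double0 => /andP[h2 h1].
apply/andP; split.
  apply: lt_le_trans h2; lra.
apply: le_lt_trans h1 _; lra.
Qed.

(* (1 + z) / (1 - z) = alpha / 16 for z = (35 + sqrt 73) / (1187 + sqrt 73). *)
Lemma ln_alphaE : ln (alpha R) = 4 * ln 2 +
  (ln (1 + (35 + Num.sqrt 73) / (1187 + Num.sqrt 73)) -
   ln (1 - (35 + Num.sqrt 73) / (1187 + Num.sqrt 73))).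
Proof.
have /andP[sl su] := sqrt73 R.
have d0 : 0 < 1187 + Num.sqrt (73 : R) by lra.
have n0 : 0 < 1222 + 2 * Num.sqrt (73 : R) by lra.
have -> : 1 + (35 + Num.sqrt 73) / (1187 + Num.sqrt 73) =
    (1222 + 2 * Num.sqrt 73) / (1187 + Num.sqrt 73) :> R by field; exact: lt0r_neq0.
have -> : 1 - (35 + Num.sqrt 73) / (1187 + Num.sqrt 73) =
    1152 / (1187 + Num.sqrt 73) :> R by field; exact: lt0r_neq0.
have c0 : 0 < 1152 :> R by lra.
have q1 := divr_gt0 n0 d0; have q2 := divr_gt0 c0 d0.
rewrite -ln_div; [|by rewrite posrE|by rewrite posrE].
have -> : 4 * ln 2 = ln (2 ^+ 4) :> R by rewrite lnXn -1?[RHS]mulr_natl.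
rewrite -lnM; [|by rewrite posrE exprn_gt0|by rewrite posrE divr_gt0].
by congr ln; rewrite /alpha; field; rewrite !lt0r_neq0.
Qed.

Lemma sqrt73_bounds : 8 + 544 / 10 ^+ 3 + 3 / 10 ^+ 6 + 745 / 10 ^+ 9 < Num.sqrt (73 : R) < 8 + 544 / 10 ^+ 3 + 3 / 10 ^+ 6 + 746 / 10 ^+ 9.
Proof.
have s0 : 0 <= Num.sqrt 73 :> R by exact: sqrtr_ge0.
have s2 : Num.sqrt 73 ^+ 2 = 73 :> R by rewrite sqr_sqrtr //; lra.
apply/andP; split; rewrite ltNge; apply/negP.
  set b := (X in _ <= X) => h; have b0 : 0 <= b by rewrite /b; lra.
  have : 0 <= (b - Num.sqrt 73) * (b + Num.sqrt 73).
    by apply: mulr_ge0; [rewrite subr_ge0|exact: addr_ge0].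
  by rewrite -subr_sqr s2 /b; lra.
set b := (X in X <= _) => h; have b0 : 0 <= b by rewrite /b; lra.
have : 0 <= (Num.sqrt 73 - b) * (Num.sqrt 73 + b).
  by apply: mulr_ge0; [rewrite subr_ge0|exact: addr_ge0].
by rewrite -subr_sqr s2 /b; lra.
Qed.

Lemma ln_alpha_bounds :
  2 * (2 + 52 / 10 ^+ 3 + 568 / 10 ^+ 6 + 97 / 10 ^+ 8) * ln 2 <= ln (alpha R)
  < 2 * (2 + 52 / 10 ^+ 3 + 568 / 10 ^+ 6 + 97 / 10 ^+ 8 + 1 / 10 ^+ 8) * ln 2.
Proof.
have /andP[sl su] := sqrt73_bounds.
have d0 : 0 < 1187 + Num.sqrt (73 : R) by lra.
rewrite ln_alphaE; set z := (35 + _) / _.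
(* Decimal enclosure of [z] from [sqrt73_bounds]. Three terms of the series suffice, the error being
   of order z^7. *)
pose zl : R := 364 / 10 ^+ 4 + 219 / 10 ^+ 7 + 163 / 10 ^+ 10 + 9 / 10 ^+ 11.
pose zu : R := 364 / 10 ^+ 4 + 219 / 10 ^+ 7 + 164 / 10 ^+ 10.
have z1 : zl <= z by rewrite ler_pdivlMr // /zl; lra.
have z2 : z <= zu by rewrite ler_pdivrMr // /zu; lra.
clear sl su; have l0 : 0 <= zl by rewrite /zl; lra.
have u1 : zu <= 1 / 2 by rewrite /zu; lra.
have /andP[k1 k2] := ln_artanh_between 3 l0 z1 z2 u1.
have /andP[l2 u2] := ln2_bounds.
clear z1 z2 l0 u1 d0; move: k1 k2; rewrite /artanh2 !big_ord_recr !big_ord0 /= !doubleS double0 /zl /zu => k1 k2.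
apply/andP; split; lra.
Qed.
End LogBounds.

(** * Conclusion *)

Section Limit.
Variable R : realType.
Local Notation alpha := (alpha R).

Lemma f2_root_cvg : (((f R 2 n)%:R : R) `^ n%:R^-1) @[n --> \oo] --> alpha.
Proof.
have c : expR (ln ((nconf n n n)%:R : R) / n%:R) @[n --> \oo] --> alpha.
  rewrite -[X in _ --> X](@lnK _ alpha) ?posrE ?alpha_gt0 //.
  exact: (cvg_comp _ _ (@ln_nconf_cvg R) (@continuous_expR R _)).
apply: cvg_trans c; apply: near_eq_cvg; near=> n.
have n0 : (0 < n)%N by near: n; exists 1%N.
by rewrite f2E // /powR gt_eqF ?nconf_diag_gt0R // mulrC.
Unshelve. all: by end_near. Qed.

Lemma c2E n : (0 < n)%N -> c R 2 n = ln ((nconf n n n)%:R : R) / n%:R / (2 * ln 2).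
Proof.
move=> n0; rewrite /c f2E // /log2.
have l2 : 0 < ln (2 : R) by rewrite ln_gt0 // ltr1n.
have n1 : n%:R != 0 :> R by rewrite pnatr_eq0 -lt0n.
by field; rewrite n1 lt0r_neq0.
Qed.

Lemma c_sup2E : c_sup R 2 = 1 / 2 * log2 alpha.
Proof.
have l2 : 0 < ln (2 : R) by rewrite ln_gt0 // ltr1n.
have l4 : 0 < 2 * ln (2 : R) by rewrite mulr_gt0.
have -> : 1 / 2 * log2 alpha = ln alpha / (2 * ln 2).
  by rewrite /log2; field; rewrite lt0r_neq0.
rewrite /c_sup; set E := (X in sup X).
have ubE : ubound E (ln alpha / (2 * ln 2)).
  move=> _ [n /= n0 <-]; rewrite c2E // ler_pM2r ?invr_gt0 //.
  by rewrite ler_pdivrMr ?ltr0n // mulrC ln_nconf_ub.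
apply/eqP; rewrite eq_le; apply/andP; split.
  by apply: ge_sup ubE; exists (c R 2 1), 1%N.
apply/ler_addgt0Pr => e e0.
have /cvgrPdist_le /(_ (e * (2 * ln 2))) := @ln_nconf_cvg R.
rewrite mulr_gt0 // => /(_ isT) [N _ /(_ N.+1 (leqnSn N)) h].
set m := N.+1 in h; have m0 : (0 < m)%N by [].
have : c R 2 m <= sup E by apply: ub_le_sup; [exists (ln alpha / (2 * ln 2))|exists m].
rewrite c2E // ler_pdivrMr // => h2.
rewrite ler_pdivrMr // mulrDl; move: h; rewrite ler_distl => /andP[_]; lra.
Qed.

End Limit.

Theorem theorem1 (R : realType) :
  [/\ (((f R 2 n)%:R : R) `^ n%:R^-1) @[n --> \oo] --> alpha R,
      c_sup R 2 = 1 / 2 * log2 (alpha R) &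
      (* 2.05256897 <= c_2 < 2.05256898, by blocks since literals are unary *)
      0 <= c_sup R 2 - (2 + 52 / 10 ^+ 3 + 568 / 10 ^+ 6 + 97 / 10 ^+ 8)
        < 1 / 10 ^+ 8].
Proof.
split; [exact: f2_root_cvg|exact: c_sup2E|rewrite c_sup2E].
have l2 : 0 < ln (2 : R) by rewrite ln_gt0 // ltr1n.
have l4 : 0 < 2 * ln (2 : R) by rewrite mulr_gt0.
have -> : 1 / 2 * log2 (alpha R) = ln (alpha R) / (2 * ln 2).
  by rewrite /log2; field; rewrite lt0r_neq0.
have /andP[h1 h2] := ln_alpha_bounds R.
rewrite subr_ge0 ltrBlDl ler_pdivlMr // ltr_pdivrMr //.
apply/andP; split.
  by rewrite mulrA [_ * 2]mulrC.
by rewrite mulrA [_ * 2]mulrC.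
Qed.
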